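(* Let $\Omega$ be a finite set of cardinality greater than three, and let $F\le F'\le\mathrm{Sym}(\Omega)$ be such that $F$ acts freely transitively on $\Omega$, $F'$ acts $2$-transitively on $\Omega$, and point stabilizers in $F'$ are perfect. Let $T$ be the $|\Omega|$-regular tree and write $G=G(F,F')^\ast$. Then the following hold: (i) $G$ admits exactly three uniformly recurrent subgroups, namely $1$, $\mathcal{S}_G(\partial T)$ and $G$, where $\mathcal{S}_G(\partial T)$ is the stabilizer URS associated to the action $G\curvearrowright\partial T$. (ii) $\mathcal{S}_G(\partial T)$ is the unique non-trivial amenable URS of $G$, and $\mathcal{S}_G(\partial T)=\{G_{\xi,0} : \xi\in\partial T\}$, where $G_{\xi,0}$ is the set of elliptic elements of $G$ that fix $\xi$, and is an infinite locally finite group.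
   Context: Let $T$ be a $|\Omega|$-regular tree with set of ends $\partial T$ (a compact space on which $\mathrm{Aut}(T)$ acts by homeomorphisms), with a fixed colouring $c\colon E(T)\to\Omega$ of its edges such that for every vertex $v$, $c$ induces a bijection $c_v$ from the set of edges around $v$ to $\Omega$. For $g\in\mathrm{Aut}(T)$ and a vertex $v$, the local permutation is $\sigma(g,v)=c_{gv}\circ g_v\circ c_v^{-1}\in\mathrm{Sym}(\Omega)$, where $g_v$ is the bijection induced by $g$ from edges around $v$ to edges around $gv$. $G(F,F')$ is the group of $g\in\mathrm{Aut}(T)$ with $\sigma(g,v)\in F'$ for all vertices $v$ and $\sigma(g,v)\in F$ for all but finitely many $v$. $G(F,F')^\ast$ is its index two subgroup preserving the types of vertices (i.e. the bipartition of the vertex set of $T$). An automorphism of $T$ is elliptic if it stabilizes a vertex or an edge. For a countable group $G$, $\mathrm{Sub}(G)$ is the space of subgroups with the topology induced from $\{0,1\}^G$, on which $G$ acts by conjugation. A URS (uniformly recurrent subgroup) is a (non-empty) closed minimal $G$-invariant subset of $\mathrm{Sub}(G)$; for $N$ normal, $\{N\}$ is denoted $N$, and $1$ denotes the trivial URS $\{\{1\}\}$. A URS is amenable if all its elements are amenable. For a minimal action of $G$ on a compact Hausdorff space $X$, with $X_0$ the set of continuity points of $x\mapsto G_x\in\mathrm{Sub}(G)$, the stabilizer URS $\mathcal{S}_G(X)$ is the closure of $\{G_x : x\in X_0\}$; it is a URS, the unique one contained in the closure of $\{G_x : x\in X\}$. *)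

(* Defs.v *)
From HB Require Import structures.
From mathcomp Require Import all_boot all_order all_algebra all_fingroup.
From mathcomp Require Import all_solvable.
From mathcomp Require Import finmap all_classical all_reals topology.

Set Implicit Arguments.
Unset Strict Implicit.
Unset Printing Implicit Defensive.

Import Order.TTheory GRing.Theory Num.Theory.

Local Open Scope classical_set_scope.
Local Open Scope group_scope.

Section Subgroups.
Variable G : groupType.

Definition is_subgroup (H : set G) : Prop :=
  [/\ H 1, forall x y, H x -> H y -> H (x * y) & forall x, H x -> H x^-1].

Definition gen_subgroup (A : set G) : set G :=
  \bigcap_(K in [set K | is_subgroup K /\ A `<=` K]) K.

Definition locally_finite (H : set G) : Prop :=
  forall A, A `<=` H -> finite_set A -> finite_set (gen_subgroup A).

(* Amenability of a subgroup as a discrete group: it carries a finitely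
   additive probability measure, defined on all its subsets and invariant
   under left translations. *)
Definition amenable (R : realType) (H : set G) : Prop :=
  exists mu : set G -> R,
    [/\ mu H = 1%R,
        forall A, A `<=` H -> (0 <= mu A)%R,
        forall A B, A `<=` H -> B `<=` H -> A `&` B = set0 ->
          mu (A `|` B) = (mu A + mu B)%R
      & forall h A, H h -> A `<=` H -> mu [set h * a | a in A] = mu A].

Record sub_space := SubSpace {
  sub_set :> set G;
  sub_setP : is_subgroup sub_set }.

Lemma sub_space_ext (H K : sub_space) : sub_set H = sub_set K -> H = K.
Proof.
case: H => H pH; case: K => K pK /= eHK; subst K.
by congr SubSpace; exact: Prop_irrelevance.
Qed.

HB.instance Definition _ := gen_eqMixin sub_space.
HB.instance Definition _ := gen_choiceMixin sub_space.

Definition sub_indicator (H : sub_space) : prod_topology (fun _ : G => bool) :=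
  fun g => `[< sub_set H g >].

HB.instance Definition _ :=
  Topological.copy sub_space (initial_topology sub_indicator).

Lemma conj_subgroup (g : G) (H : sub_space) :
  is_subgroup [set g * h * g^-1 | h in sub_set H].
Proof.
have [H1 HM HV] := sub_setP H; split.
- by exists 1 => //; rewrite mulg1 mulgV.
- move=> _ _ [x Hx <-] [y Hy <-]; exists (x * y); first exact: HM.
  by rewrite !mulgA mulgVK.
- move=> _ [x Hx <-]; exists x^-1; first exact: HV.
  by rewrite !invgM invgK mulgA.
Qed.

Definition conj_sub (g : G) (H : sub_space) : sub_space :=
  SubSpace (conj_subgroup g H).

Definition conj_invariant (U : set sub_space) : Prop :=
  forall g H, U H -> U (conj_sub g H).

Definition is_URS (U : set sub_space) : Prop :=
  [/\ U !=set0, closed U, conj_invariant U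
    & forall V, V !=set0 -> closed V -> conj_invariant V -> V `<=` U -> V = U].

Definition amenable_URS (R : realType) (U : set sub_space) : Prop :=
  forall H, U H -> amenable R (sub_set H).

Lemma trivial_is_subgroup : is_subgroup [set 1 : G].
Proof.
by split=> // [x y -> ->|x ->] /=; rewrite ?mulg1 ?invg1.
Qed.

Lemma full_is_subgroup : is_subgroup [set: G].
Proof. by []. Qed.

Definition trivial_URS : set sub_space := [set SubSpace trivial_is_subgroup].
Definition full_URS : set sub_space := [set SubSpace full_is_subgroup].

Record homeo_action (X : topologicalType) := HomeoAction {
  hact :> G -> X -> X;
  hact1 : forall x, hact 1 x = x;
  hactM : forall g h x, hact (g * h) x = hact g (hact h x);
  hact_continuous : forall g, continuous (hact g) }.

Variables (X : topologicalType) (to : homeo_action X).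

Lemma stab_is_subgroup (x : X) : is_subgroup [set g | to g x = x].
Proof.
split=> /=; first exact: hact1.
- by move=> g h gx hx; rewrite hactM hx.
- by move=> g gx; rewrite -{1}gx -hactM mulVg hact1.
Qed.

Definition stab (x : X) : sub_space := SubSpace (stab_is_subgroup x).

Definition stabilizer_URS : set sub_space :=
  closure [set stab x | x in [set x | {for x, continuous stab}]].

End Subgroups.

Arguments trivial_URS : clear implicits.
Arguments full_URS : clear implicits.

Record tree := Tree {
  vertex :> choiceType;
  adj : rel vertex;
  tree_inhabited : inhabited vertex;
  adj_sym : symmetric adj;
  adj_irr : irreflexive adj;
  tree_connected : forall v w, exists2 p, path adj v p & last v p = w;
  tree_acyclic : forall p : seq vertex, (2 < size p)%N -> ~ ucycle adj p }.

Arguments adj {t} : rename.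

Definition regular_tree (n : nat) (T : tree) : Prop :=
  forall v : T, ([set w : T | adj v w] #= `I_n)%card.

Section Automorphisms.
Variable T : tree.

Record Aut_tree := AutTree {
  aut_fun :> T -> T;
  aut_bij : bijective aut_fun;
  aut_adj : forall v w, adj (aut_fun v) (aut_fun w) = adj v w }.

Lemma aut_ext (g h : Aut_tree) : aut_fun g =1 aut_fun h -> g = h.
Proof.
case: g => g bg ag; case: h => h bh ah /= /funext egh; subst h.
by congr AutTree; exact: Prop_irrelevance.
Qed.

HB.instance Definition _ := gen_eqMixin Aut_tree.
HB.instance Definition _ := gen_choiceMixin Aut_tree.

Definition aut_one : Aut_tree :=
  @AutTree idfun (Bijective (fun=> erefl) (fun=> erefl)) (fun _ _ => erefl).

Lemma aut_mul_adj (g h : Aut_tree) v w : adj ((g \o h) v) ((g \o h) w) = adj v w.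
Proof. by rewrite /= !aut_adj. Qed.

Definition aut_mul (g h : Aut_tree) : Aut_tree :=
  AutTree (bij_comp (aut_bij g) (aut_bij h)) (aut_mul_adj g h).

Lemma aut_inv_exists (g : Aut_tree) :
  exists f : T -> T, cancel g f /\ cancel f g.
Proof. by have [f gK fK] := aut_bij g; exists f. Qed.

Definition aut_inv_fun (g : Aut_tree) : T -> T := projT1 (cid (aut_inv_exists g)).

Lemma aut_funK g : cancel (aut_fun g) (aut_inv_fun g).
Proof. by rewrite /aut_inv_fun; case: (cid _) => /= f []. Qed.

Lemma aut_inv_funK g : cancel (aut_inv_fun g) (aut_fun g).
Proof. by rewrite /aut_inv_fun; case: (cid _) => /= f []. Qed.

Lemma aut_inv_adj g v w : adj (aut_inv_fun g v) (aut_inv_fun g w) = adj v w.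
Proof. by rewrite -(aut_adj g) !aut_inv_funK. Qed.

Definition aut_inv (g : Aut_tree) : Aut_tree :=
  AutTree (Bijective (aut_inv_funK g) (aut_funK g)) (aut_inv_adj g).

Lemma aut_mulA : associative aut_mul.
Proof. by move=> g h k; exact: aut_ext. Qed.
Lemma aut_mul1g : left_id aut_one aut_mul.
Proof. by move=> g; exact: aut_ext. Qed.
Lemma aut_mulg1 : right_id aut_one aut_mul.
Proof. by move=> g; exact: aut_ext. Qed.
Lemma aut_mulVg : left_inverse aut_one aut_inv aut_mul.
Proof. by move=> g; apply: aut_ext => v; exact: aut_funK. Qed.
Lemma aut_mulgV : right_inverse aut_one aut_inv aut_mul.
Proof. by move=> g; apply: aut_ext => v; exact: aut_inv_funK. Qed.

HB.instance Definition _ := isGroup.Build Aut_tree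
  aut_mulA aut_mul1g aut_mulg1 aut_mulVg aut_mulgV.

Definition elliptic (g : Aut_tree) : Prop :=
  (exists v, g v = v) \/
  (exists v w, adj v w /\ [set g v; g w] = [set v; w]).

(* The two types are the classes of the bipartition of the vertices. *)
Definition same_type (v w : T) : Prop :=
  exists p, [/\ path adj v p, last v p = w & ~~ odd (size p)].

Definition type_preserving (g : Aut_tree) : Prop := forall v, same_type v (g v).

Lemma path_aut (g : Aut_tree) v p : path adj (g v) (map g p) = path adj v p.
Proof. by elim: p v => //= w p IHp v; rewrite aut_adj IHp. Qed.

Lemma same_type_sym v w : same_type v w -> same_type w v.
Proof.
move=> [p [pp <- op]]; exists (rev (belast v p)); split.
- by rewrite (eq_path (e' := fun x y => adj y x)) ?rev_path // => x y; exact: adj_sym.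
- by case: p {pp op} => //= x p; rewrite rev_cons last_rcons.
- by rewrite size_rev size_belast.
Qed.

Lemma same_type_trans u v w : same_type u v -> same_type v w -> same_type u w.
Proof.
move=> [p [pp <- op]] [q [pq <- oq]]; exists (p ++ q).
by rewrite cat_path last_cat size_cat oddD pp pq (negbTE op) (negbTE oq).
Qed.

Lemma type_preserving1 : type_preserving 1.
Proof. by move=> v; exists [::]. Qed.

Lemma type_preservingM g h :
  type_preserving g -> type_preserving h -> type_preserving (g * h).
Proof. by move=> tg th v; exact: same_type_trans (th v) (tg (h v)). Qed.

Lemma type_preservingV g : type_preserving g -> type_preserving g^-1.
Proof.
move=> tg v; apply: same_type_sym.
by have := tg (g^-1 v); rewrite (aut_inv_funK g).
Qed.

Definition is_ray (r : nat -> T) : Prop :=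
  injective r /\ forall n, adj (r n) (r n.+1).

Definition cofinal (r s : nat -> T) : Prop :=
  exists m n, forall k, r (m + k)%N = s (n + k)%N.

Record tree_end := TreeEnd {
  end_rays :> set (nat -> T);
  end_raysP : exists r, is_ray r /\
    end_rays = [set s | is_ray s /\ cofinal r s] }.

Lemma end_ext (xi eta : tree_end) : end_rays xi = end_rays eta -> xi = eta.
Proof.
case: xi => E pE; case: eta => E' pE' /= eE; subst E'.
by congr TreeEnd; exact: Prop_irrelevance.
Qed.

HB.instance Definition _ := gen_eqMixin tree_end.
HB.instance Definition _ := gen_choiceMixin tree_end.

(* The component of w in T minus the vertex v, i.e., when v and w are adjacent,
   the half-tree on the side of w of the edge {v, w}. *)
Definition half_tree (v w : T) : set T :=
  [set u | exists p, [/\ path adj w p, last w p = u & v \notin w :: p]].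

Definition shadow (v w : T) : set tree_end :=
  [set xi | exists2 r, end_rays xi r & \forall k \near \oo, half_tree v w (r k)].

Definition end_subbase : set (set tree_end) :=
  [set A | exists v w, adj v w /\ A = shadow v w].

HB.instance Definition _ := isSubBaseTopological.Build tree_end end_subbase id.

Lemma is_ray_aut (g : Aut_tree) r : is_ray r -> is_ray (g \o r).
Proof.
move=> [ir ar]; split; last by move=> n /=; rewrite aut_adj.
exact: inj_comp (bij_inj (aut_bij g)) ir.
Qed.

Lemma cofinal_aut (g : Aut_tree) r s : cofinal r s -> cofinal (g \o r) (g \o s).
Proof. by move=> [m [n rs]]; exists m, n => k /=; rewrite rs. Qed.

Lemma end_image_subproof (g : Aut_tree) (xi : tree_end) :
  exists r, is_ray r /\
    [set (aut_fun g) \o s | s in end_rays xi] =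
    [set s | is_ray s /\ cofinal r s].
Proof.
have [r [rr ->]] := end_raysP xi.
exists (g \o r); split; first exact: is_ray_aut.
apply/seteqP; split=> [_ [s [rs crs] <-]|s [rs crs]].
  by split; [exact: is_ray_aut | exact: cofinal_aut].
exists (aut_inv g \o s); last by apply/funext => n /=; rewrite aut_inv_funK.
split; first exact: is_ray_aut.
have := cofinal_aut (aut_inv g) crs.
by congr cofinal; apply/funext => n /=; rewrite aut_funK.
Qed.

Definition end_act (g : Aut_tree) (xi : tree_end) : tree_end :=
  TreeEnd (end_image_subproof g xi).

Lemma end_act1 xi : end_act 1 xi = xi.
Proof.
apply: end_ext; apply/seteqP; split=> [_ [s xis <-] //|s xis].
by exists s.
Qed.

Lemma end_actM g h xi : end_act (g * h) xi = end_act g (end_act h xi).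
Proof.
apply: end_ext; apply/seteqP; split=> [_ [s xis <-]|_ [_ [s xis <-] <-]].
  by exists (h \o s) => //; exists s.
by exists s.
Qed.

Lemma half_tree_aut (g : Aut_tree) v w u :
  half_tree v w u -> half_tree (g v) (g w) (g u).
Proof.
move=> [p [pp <- vp]]; exists (map g p); split.
- by rewrite path_aut.
- by rewrite last_map.
- by rewrite -map_cons mem_map //; exact: bij_inj (aut_bij g).
Qed.

Lemma shadow_aut (g : Aut_tree) v w xi :
  shadow v w xi -> shadow (g v) (g w) (end_act g xi).
Proof.
move=> [r xir nr]; exists (g \o r); first by exists r.
by apply: filterS nr => k; exact: half_tree_aut.
Qed.

Lemma shadow_preimage (g : Aut_tree) v w :
  end_act g @^-1` shadow v w = shadow (g^-1 v) (g^-1 w).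
Proof.
apply/seteqP; split=> xi /= sxi.
  by have := shadow_aut g^-1 sxi; rewrite -end_actM mulVg end_act1.
have := shadow_aut g sxi.
by rewrite !(aut_inv_funK g).
Qed.

Lemma end_act_continuous (g : Aut_tree) : continuous (end_act g).
Proof.
apply/continuousP => _ [D sD <-].
exists [set end_act g @^-1` B | B in D].
  move=> _ [B /sD [E sE <-] <-].
  exists [fset (end_act g @^-1` A) | A in E]%fset.
    move=> _ /imfsetP [A /= /sE/set_mem [v [w [vw ->]]] ->].
    apply/mem_set; exists (g^-1 v), (g^-1 w); split; last exact: shadow_preimage.
    by rewrite (aut_inv_adj g).
  apply/seteqP; split=> xi /= Exi.
    move=> A EA; apply: (Exi (end_act g @^-1` A)).
    by apply/imfsetP; exists A.
  by move=> _ /imfsetP [A /= EA ->]; exact: Exi.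
by rewrite bigcup_image preimage_bigcup.
Qed.

End Automorphisms.

(* An edge colouring is a symmetric function of the two endpoints of the edge;
   its values on pairs of non-adjacent vertices are never used. *)
Record legal_colouring (Omega : finType) (T : tree) := LegalColouring {
  colour :> T -> T -> Omega;
  colour_sym : forall v w, adj v w -> colour v w = colour w v;
  colour_bij : forall v a, exists! w, adj v w /\ colour v w = a }.

Section LocalAction.
Variables (Omega : finType) (T : tree) (c : legal_colouring Omega T).
Implicit Types (g h : Aut_tree T) (v w : T) (a : Omega).

(* The inverse of the bijection c_v from the edges around v to Omega; an edge
   around v is identified with its other endpoint. *)
Definition neighbour v a : T := projT1 (cid (colour_bij c v a)).

Lemma neighbour_adj v a : adj v (neighbour v a).
Proof. by rewrite /neighbour; case: (cid _) => /= w [[]]. Qed.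

Lemma colour_neighbour v a : c v (neighbour v a) = a.
Proof. by rewrite /neighbour; case: (cid _) => /= w [[]]. Qed.

Lemma neighbour_colour v w : adj v w -> neighbour v (c v w) = w.
Proof.
by rewrite /neighbour; case: (cid _) => /= u [_ uu] vw; exact: uu.
Qed.

Definition local_fun g v a : Omega := c (g v) (g (neighbour v a)).

Lemma local_fun_inj g v : injective (local_fun g v).
Proof.
move=> a b; rewrite /local_fun => /(congr1 (neighbour (g v))).
rewrite !neighbour_colour ?aut_adj ?neighbour_adj //.
move=> /(bij_inj (aut_bij g)) /(congr1 (c v)).
by rewrite !colour_neighbour.
Qed.

Definition local_perm g v : {perm Omega} := perm (@local_fun_inj g v).

Lemma local_perm1 v : local_perm 1 v = 1.
Proof. by apply/permP => a; rewrite permE perm1 /local_fun colour_neighbour. Qed.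

(* Permutations are composed from left to right in [perm]. *)
Lemma local_permM g h v :
  local_perm (g * h) v = local_perm h v * local_perm g (h v).
Proof.
apply/permP => a; rewrite permM !permE /local_fun neighbour_colour //.
by rewrite aut_adj neighbour_adj.
Qed.

Lemma local_permV g v : local_perm g^-1 v = (local_perm g (g^-1 v))^-1.
Proof.
apply/eqP; rewrite eq_mulgV1 invgK -local_permM mulgV local_perm1; exact/eqP.
Qed.

Variables F F' : {group {perm Omega}}.

Definition in_GFF g : Prop :=
  (forall v, local_perm g v \in F') /\
  finite_set [set v | local_perm g v \notin F].

Definition GFF_star : {pred Aut_tree T} :=
  fun g => `[< in_GFF g /\ type_preserving g >].

Lemma GFF_star_group_closed : group_closed GFF_star.
Proof.
split.
  apply/asboolP; split; last exact: type_preserving1.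
  split=> [v|]; first by rewrite local_perm1 group1.
  rewrite (_ : mkset _ = set0) //; apply/seteqP; split=> // v /=.
  by rewrite local_perm1 group1.
move=> g h /asboolP [[gF' gF] tg] /asboolP [[hF' hF] th]; apply/asboolP.
split; last by apply: type_preservingM => //; exact: type_preservingV.
split=> [v|]; first by rewrite local_permM groupM // local_permV groupV.
apply: (@sub_finite_set _ _
  ([set h v | v in [set v | local_perm g v \notin F]] `|`
   [set h v | v in [set v | local_perm h v \notin F]])).
  move=> v /=; rewrite local_permM local_permV => nF.
  have hv : h (h^-1 v) = v by exact: (aut_inv_funK h).
  have [hvF|] := boolP (local_perm h (h^-1 v) \in F); last first.
    by right; exists (h^-1 v).
  left; exists (h^-1 v) => //=; apply: contra nF => gvF.
  by rewrite groupM // groupV.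
by rewrite finite_setU; split; exact: finite_image.
Qed.

Record GFF_star_type := GFFStar {
  GFF_val :> Aut_tree T;
  GFF_valP : GFF_val \in GFF_star }.

HB.instance Definition _ := [isSub for GFF_val].
HB.instance Definition _ := [Choice of GFF_star_type by <:].
HB.instance Definition _ := SubChoice_isSubGroup.Build
  (Aut_tree T) GFF_star GFF_star_type GFF_star_group_closed.

Definition GFF_end_act (g : GFF_star_type) (xi : tree_end T) : tree_end T :=
  end_act (GFF_val g) xi.

Lemma GFF_end_act1 xi : GFF_end_act 1 xi = xi.
Proof. exact: end_act1. Qed.

Lemma GFF_end_actM (g h : GFF_star_type) xi :
  GFF_end_act (g * h) xi = GFF_end_act g (GFF_end_act h xi).
Proof. exact: end_actM. Qed.

Lemma GFF_end_act_continuous (g : GFF_star_type) : continuous (GFF_end_act g).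
Proof. exact: end_act_continuous. Qed.

Definition boundary_action : homeo_action GFF_star_type (tree_end T) :=
  HomeoAction GFF_end_act1 GFF_end_actM GFF_end_act_continuous.

Definition elliptic_stab (xi : tree_end T) : set GFF_star_type :=
  [set g | elliptic (GFF_val g) /\ boundary_action g xi = xi].

End LocalAction.

Arguments elliptic_stab {Omega T} c F F' xi.

Section PermGroups.
Variables (Omega : finType) (F : {group {perm Omega}}).

Definition freely_transitive : Prop :=
  [transitive F, on [set: Omega]%SET | 'P] /\
  forall a : Omega, 'C_F[a | 'P] = 1.

Definition two_transitive : Prop := [transitive^2 F, on [set: Omega]%SET | 'P].

Definition perfect_point_stabilizers : Prop :=
  forall a : Omega, ('C_F[a | 'P])^`(1) = 'C_F[a | 'P].

End PermGroups.

(* Main.v *)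
Require Import Defs.
From mathcomp Require Import all_boot all_order all_algebra all_fingroup all_solvable.
From mathcomp Require Import finmap all_classical all_reals topology normedtype lra.

(** Write [G] for the group and [G_xi] for the elliptic stabiliser of an end
    [xi].

    The colouring identifies the vertices of the tree with the reduced words in
    the colours ([word]), the ends with the infinite ones ([eword]), and an
    automorphism with the image of a vertex and its local permutations. As [F]
    acts freely, an element that fixes an edge and has its local permutations
    beyond this edge in [F] is trivial there ([fixes_branch]). Hence an elliptic
    element of [G] that fixes an end fixes a half-tree around it
    ([ell_branch]): the group [G_xi] is the increasing union of the fixators of
    the half-trees around [xi]. This makes it locally finite
    ([ell_locally_finite]), thus amenable, and shows that it depends
    continuously on [xi] ([ell_near1]). A hyperbolic element can fix [xi] only
    if the colours of the rays to [xi] are eventually periodic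
    ([hyperbolic_periodic]); the other ends are dense, and the stabiliser of
    such an end is [G_xi]. So the stabiliser URS consists of all the [G_xi], by
    compactness of the space of ends ([stabilizer_URSE]).

    Let [U] be a non-trivial URS. It avoids a neighbourhood of the trivial
    subgroup, so there are finitely many non-trivial elements [p i] such that
    each member of [U] contains one of them ([confined]). For [K] in [U], all
    conjugates of [K] are in [U]; conjugating by products [g] of elements
    supported in well-chosen disjoint half-trees, one finds many elements
    [g^-1 * p i * g] in [K]. Which index [i] occurs is not under control, but a
    diagonal argument shows that for some [i] the component of [g] in the
    half-tree of index [i] is arbitrary ([select_exists]). A counting argument
    ([diagonal_colouring]) provides two such families, with the same index [i]
    and the same half-tree for [i], but disjoint half-trees for the other
    indices. Commutators of quotients of elements of the two families are
    arbitrary commutators in the rigid stabiliser of a half-tree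
    ([contains_commutators]). This rigid stabiliser is perfect, because the
    point stabilisers of [F'] are ([rist_perfect]); so [K] contains it.

    Conjugating this half-tree towards an end [xi] fixed by no hyperbolic
    element, a limit [H] in [U] of conjugates of [K] contains [G_xi]
    ([nontrivial_contains_ell]). If [H] fixes [xi], then [H] is [G_xi] and [U]
    is the stabiliser URS by minimality. Otherwise [H] contains the elliptic
    stabilisers of two ends, and these generate [G] because two point
    stabilisers generate the 2-transitive group [F'] ([moves_end_full]); so [U]
    is [G]. Finally [G] is not amenable ([G_not_amenable]), as its action on
    half-trees shows. *)

Set Implicit Arguments.
Unset Strict Implicit.
Unset Printing Implicit Defensive.

Local Open Scope classical_set_scope.

(** * Vertices as reduced words in the colours *)

Section Words.
Local Open Scope group_scope.
Variables (Omega : finType) (T : tree) (c : legal_colouring Omega T).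
Implicit Types (v w x y : T) (s t : seq Omega) (a b : Omega).
Local Notation nb := (neighbour c).

Definition reduced s := sorted (fun a b : Omega => a != b) s.
Arguments reduced : simpl never.
Definition walk v s : T := foldl (neighbour c) v s.

Lemma colour_neighbourV v a : c (nb v a) v = a.
Proof. by rewrite -colour_sym ?neighbour_adj // colour_neighbour. Qed.

Lemma neighbourK v a : nb (nb v a) a = v.
Proof.
by rewrite -{2}(colour_neighbourV v a) neighbour_colour // adj_sym neighbour_adj.
Qed.

Lemma neighbour_inj v : injective (nb v).
Proof. by move=> a b /(congr1 (c v)); rewrite !colour_neighbour. Qed.

Lemma walk_cat v s t : walk v (s ++ t) = walk (walk v s) t.
Proof. exact: foldl_cat. Qed.

Lemma walk_rcons v s a : walk v (rcons s a) = nb (walk v s) a.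
Proof. by rewrite -cats1 walk_cat. Qed.

Lemma walk_rev v s : walk (walk v s) (rev s) = v.
Proof.
elim: s v => //= a s IH v.
by rewrite rev_cons walk_rcons IH neighbourK.
Qed.

Lemma path_walk v s : path adj v (scanl (neighbour c) v s).
Proof. by elim: s v => //= a s IH v; rewrite neighbour_adj IH. Qed.

Lemma last_scanl_walk v s : last v (scanl (neighbour c) v s) = walk v s.
Proof. by elim: s v => //= a s IH v; rewrite IH. Qed.

Lemma path_walkP v (p : seq T) : path adj v p ->
  exists2 s, last v p = walk v s & size s = size p.
Proof.
elim: p v => [|x p IH] v /=; first by exists [::].
case/andP=> vx /IH [s -> <-]; exists (c v x :: s) => //=.
by rewrite neighbour_colour.
Qed.

(** If the walk repeats a vertex, then a shorter closed walk without
    backtracking lies inside it; otherwise it is a cycle, and the tree has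
    none. *)
Lemma reduced_closed s v : reduced s -> walk v s = v -> s = [::].
Proof.
have [n] := ubnP (size s); elim: n s v => // n IH s v /ltnSE sn rs sv.
case: (posnP (size s)) => [/size0nil //|s0].
pose p := scanl (neighbour c) v s.
have sp : size p = size s by rewrite size_scanl.
have lp : last v p = v by rewrite last_scanl_walk.
have np i : (i < size s)%N -> nth v p i = walk v (take i.+1 s).
  by move=> si; rewrite /p nth_scanl.
have up : uniq p.
  apply: contraT => /(uniqPn v) [i [j [ij]]]; rewrite sp => js.
  have is_ := ltn_trans ij js; rewrite !np // => eij.
  pose t := drop i.+1 (take j.+1 s).
  have et : take j.+1 s = take i.+1 s ++ t.
    by rewrite -{1}(cat_take_drop i.+1 (take j.+1 s)) take_takel // ltnW.
  have := IH t (walk v (take i.+1 s)); rewrite -walk_cat -et.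
  have szt : size t = (j - i)%N by rewrite size_drop size_takel // subSS.
  rewrite szt => /(_ _ _ (esym eij)) t0.
  suff : t = [::] by move=> E; move: szt; rewrite E => /esym/eqP; rewrite subn_eq0 leqNgt ij.
  apply: t0; last by apply: drop_sorted; apply: take_sorted.
  by apply: leq_trans sn; rewrite (leq_ltn_trans (leq_subr i j)).
have cp : path.cycle adj p.
  move: lp (path_walk v s); rewrite -/p; case: (p) => //= x q <-.
  by rewrite rcons_path => /andP [-> ->].
(* Only words of length at most two are left, as cycles have length at least
   three. *)
have s2 : (size s <= 2)%N.
  rewrite leqNgt; apply/negP => s3.
  by apply: (@tree_acyclic T p); rewrite ?sp // /ucycle cp up.
move: rs sv s0 s2; case: (s) => //= a [|b [|]] //=.
  by move=> _ E; have := neighbour_adj c v a; rewrite E adj_irr.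
rewrite /reduced /= andbT => ab E _ _; case/negP: ab; apply/eqP.
by apply: (@neighbour_inj (nb v a)); rewrite neighbourK E.
Qed.

Lemma reduced_cons a s : reduced (a :: s) = (ohead s != Some a) && reduced s.
Proof.
rewrite /reduced; case: s => //= b s.
by rewrite (inj_eq (@Some_inj _)) eq_sym.
Qed.

Lemma reduced_catrev s t : reduced s -> reduced t -> ohead s != ohead t ->
  reduced (rev s ++ t).
Proof.
elim: s t => //= a s IH t; rewrite reduced_cons => /andP [as_ rs] rt ht.
rewrite rev_cons cat_rcons; apply: IH => //.
by rewrite reduced_cons rt andbT eq_sym.
Qed.

(** Once a common prefix is removed, running back along one word and then
    along the other is a closed walk without backtracking. *)
Lemma walk_inj v s t :
  reduced s -> reduced t -> walk v s = walk v t -> s = t.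
Proof.
elim: s t v => [|a s IH] t v rs rt E.
  by apply/esym/(reduced_closed rt (v:=v)); rewrite -E.
have [ht|ht] := eqVneq (ohead (a :: s)) (ohead t); last first.
  have E0 : rev (a :: s) ++ t = [::].
    apply: (@reduced_closed _ (walk v (a :: s))); first exact: reduced_catrev.
    by rewrite walk_cat walk_rev E.
  by move/(congr1 size): E0; rewrite size_cat size_rev.
case: t rt E ht => //= b t rt E [ab]; rewrite -ab in rt E *.
congr cons; apply: (IH t (nb v a)) => //.
  by move: rs; rewrite reduced_cons => /andP [].
by move: rt; rewrite reduced_cons => /andP [].
Qed.

(** Left multiplication by a generator in the free product of copies of
    [Z/2] indexed by the colours. *)
Definition lmul a s :=
  if ohead s == Some a then behead s else a :: s.

Lemma reduced_lmul a s : reduced s -> reduced (lmul a s).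
Proof.
rewrite /lmul; case: ifPn => [_|]; last by rewrite reduced_cons => -> ->.
by case: s => //= b s; rewrite reduced_cons => /andP [].
Qed.

Lemma walk_lmul v a s : walk v (lmul a s) = walk (nb v a) s.
Proof.
rewrite /lmul; case: ifPn => //; case: s => //= b s /eqP [->].
by rewrite neighbourK.
Qed.

Definition norm s := foldr lmul [::] s.

Lemma reduced_norm s : reduced (norm s).
Proof. by elim: s => //= a s /reduced_lmul. Qed.

Lemma walk_norm v s : walk v (norm s) = walk v s.
Proof. by elim: s v => //= a s IH v; rewrite walk_lmul IH. Qed.

Lemma word_exists v x : exists s, reduced s /\ walk v s = x.
Proof.
have [p pp <-] := tree_connected v x; have [s -> _] := path_walkP pp.
by exists (norm s); split; rewrite ?reduced_norm ?walk_norm.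
Qed.

(** The colours met along the geodesic from one vertex to another. *)
Definition word v x : seq Omega := projT1 (cid (word_exists v x)).

Lemma word_reduced v x : reduced (word v x).
Proof. by rewrite /word; case: cid => s []. Qed.

Lemma walk_word v x : walk v (word v x) = x.
Proof. by rewrite /word; case: cid => s []. Qed.

Lemma word_walk v s : word v (walk v s) = norm s.
Proof.
apply: (@walk_inj v); rewrite ?word_reduced ?reduced_norm //.
by rewrite walk_word walk_norm.
Qed.

Lemma norm_reduced s : reduced s -> norm s = s.
Proof.
elim: s => //= a s IH; rewrite reduced_cons => /andP [as_ rs].
by rewrite IH // /lmul (negbTE as_).
Qed.

Lemma word_walk_reduced v s : reduced s -> word v (walk v s) = s.
Proof. by move=> rs; rewrite word_walk norm_reduced. Qed.

Lemma wordxx v : word v v = [::].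
Proof. exact: (@word_walk_reduced v [::]). Qed.

Lemma word_nil v x : word v x = [::] -> x = v.
Proof. by move=> E; rewrite -(walk_word v x) E. Qed.

Lemma word_neighbour v a x : word (nb v a) x = lmul a (word v x).
Proof.
apply: (@walk_inj (nb v a)); rewrite ?reduced_lmul ?word_reduced //.
by rewrite walk_lmul neighbourK !walk_word.
Qed.

Lemma norm_map (f : {perm Omega}) s : norm (map f s) = map f (norm s).
Proof.
elim: s => //= a s ->; rewrite /lmul; case: (norm s) => //= b t.
by rewrite !(inj_eq (@Some_inj _)) (inj_eq perm_inj); case: ifP.
Qed.

(** The half-tree beyond the edge of colour [a] at [v]. *)
Definition branch v a : set T := [set x | ohead (word v x) == Some a].

Lemma branch_irr v a : ~ branch v a v.
Proof. by rewrite /branch /= wordxx. Qed.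

Lemma branch_neighbour v a : branch v a (nb v a).
Proof. by rewrite /branch /= (@word_walk_reduced v [:: a]). Qed.

Lemma branch_walk v a x : branch v a x ->
  exists2 s, reduced (a :: s) & x = walk v (a :: s).
Proof.
rewrite /branch /=; have := word_reduced v x; have := walk_word v x.
by case: (word v x) => // b s <- rs /eqP [ba]; rewrite ba in rs *; exists s.
Qed.

Lemma branch_disj v a b x : branch v a x -> branch v b x -> a = b.
Proof. by rewrite /branch /= => /eqP -> /eqP []. Qed.

Lemma branch_cases v x : x = v \/ exists a, branch v a x.
Proof.
case E: (word v x) => [|a s]; first by left; apply: word_nil.
by right; exists a; rewrite /branch /= E.
Qed.

Lemma branchC v a x : branch (nb v a) a x <-> ~ branch v a x.
Proof.
rewrite /branch /= word_neighbour; split.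
  rewrite /lmul => + E; rewrite E.
  have := word_reduced v x; case: (word v x) E => // b s /eqP [->] /=.
  by rewrite reduced_cons => /andP [/negbTE ->].
by move=> /negP/negbTE E; rewrite /lmul E.
Qed.

Lemma sub_branch v a b : b <> a -> branch (nb v a) b `<=` branch v a.
Proof.
move=> ba x bx; apply: contrapT => /branchC ax.
exact: ba (branch_disj bx ax).
Qed.

End Words.

Arguments reduced {Omega} s : simpl never.
Arguments branch : simpl never.

(** * Automorphisms and their local permutations *)

Section Auts.
Local Open Scope group_scope.
Variables (Omega : finType) (T : tree) (c : legal_colouring Omega T).
Implicit Types (v w x y u : T) (s t : seq Omega) (a b d : Omega).
Implicit Types (g h k : Aut_tree T) (f : {perm Omega}).
Local Notation nb := (neighbour c).
Local Notation word := (word c).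
Local Notation walk := (walk c).
Local Notation branch := (branch c).
Local Notation lp := (local_perm c).

Lemma aut_invK g x : g^-1 (g x) = x. Proof. exact: (aut_funK g). Qed.

Lemma aut_Kinv g x : g (g^-1 x) = x. Proof. exact: (aut_inv_funK g). Qed.

Lemma aut_inj g : injective g. Proof. exact: bij_inj (aut_bij g). Qed.

Lemma adj_neighbour x y : adj x y -> exists a, y = nb x a.
Proof. by move=> xy; exists (c x y); rewrite neighbour_colour. Qed.

Lemma aut_neighbour g v a : g (nb v a) = nb (g v) (lp g v a).
Proof. by rewrite permE /local_fun neighbour_colour // aut_adj neighbour_adj. Qed.

Lemma local_perm_edge g v a : lp g (nb v a) a = lp g v a.
Proof.
apply: (@neighbour_inj _ _ c (g (nb v a))).
by rewrite -aut_neighbour neighbourK [in RHS]aut_neighbour neighbourK.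
Qed.

Fixpoint lword g v s : seq Omega :=
  if s is a :: s' then lp g v a :: lword g (nb v a) s' else [::].

Lemma aut_walk g v s : g (walk v s) = walk (g v) (lword g v s).
Proof. by elim: s v => //= a s IH v; rewrite IH aut_neighbour. Qed.

Lemma reduced_lword g v s : reduced s -> reduced (lword g v s).
Proof.
elim: s v => //= a s IH v; rewrite !reduced_cons => /andP [as_ /IH ->].
rewrite andbT; case: s as_ {IH} => //= b s.
by rewrite !(inj_eq (@Some_inj _)) -(local_perm_edge g v a) (inj_eq perm_inj).
Qed.

Lemma word_aut g v x : word (g v) (g x) = lword g v (word v x).
Proof.
rewrite -{1}(walk_word c v x) aut_walk word_walk_reduced //.
by rewrite reduced_lword // word_reduced.
Qed.

Lemma size_lword g v s : size (lword g v s) = size s.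
Proof. by elim: s v => //= a s IH v; rewrite IH. Qed.

Lemma branch_aut g v a x : branch (g v) (lp g v a) (g x) <-> branch v a x.
Proof.
rewrite /branch /= word_aut; case: (word v x) => //= b s.
by rewrite !(inj_eq (@Some_inj _)) (inj_eq perm_inj).
Qed.

Lemma branch_step u d x a : branch u d x ->
  branch u d (nb x a) \/ x = nb u d /\ a = d.
Proof.
rewrite /branch /=; move: (word_reduced c u x) (walk_word c u x).
case: (word u x) => // e s + + /eqP [ed]; rewrite {}ed => rs <-.
have [da|da] := eqVneq (last d s) a; last first.
  left; rewrite -walk_rcons word_walk_reduced //=.
  by move: rs; rewrite /reduced /= rcons_path => ->.
case: (lastP s) da rs => [|t b] /=; first by move=> ->; right.
rewrite last_rcons => -> {b}.
rewrite /reduced /= rcons_path => /andP [rt _]; left.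
rewrite -[walk _ (rcons _ _)]/(walk u (rcons (d :: t) a)).
by rewrite walk_rcons neighbourK word_walk_reduced /=.
Qed.

Lemma odd_size_norm s : odd (size (norm s)) = odd (size s).
Proof.
elim: s => //= a s <-; rewrite /lmul.
by case: (norm s) => //= b t; case: ifP => //=; rewrite negbK.
Qed.

Lemma odd_path v (p : seq T) : path adj v p ->
  odd (size (word v (last v p))) = odd (size p).
Proof. by move=> /(path_walkP c) [s -> <-]; rewrite word_walk odd_size_norm. Qed.

Definition odd_dist v w := odd (size (word v w)).

Lemma same_typeP v w : same_type v w <-> ~~ odd_dist v w.
Proof.
split=> [[p [pp <- op]]|o]; first by rewrite /odd_dist odd_path.
exists (scanl (neighbour c) v (word v w)).
by rewrite path_walk last_scanl_walk walk_word size_scanl.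
Qed.

Lemma odd_dist_add u v w : odd_dist u w = odd_dist u v (+) odd_dist v w.
Proof.
rewrite /odd_dist -{1}(walk_word c v w) -{1}(walk_word c u v) -walk_cat.
by rewrite word_walk odd_size_norm size_cat oddD.
Qed.

Lemma odd_dist_sym u v : odd_dist u v = odd_dist v u.
Proof.
have := odd_dist_add u v u; rewrite {1}/odd_dist wordxx /=.
by do 2!case: odd_dist.
Qed.

Lemma odd_dist_aut g u v : odd_dist (g u) (g v) = odd_dist u v.
Proof. by rewrite /odd_dist word_aut size_lword. Qed.

Lemma odd_dist_neighbour v a w : odd_dist (nb v a) w = ~~ odd_dist v w.
Proof.
rewrite /odd_dist word_neighbour /lmul.
by case: (word v w) => //= b s; case: ifP => //=; rewrite negbK.
Qed.

(** The parity of the distance is additive, so whether it is even between a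
    vertex and its image does not depend on the vertex. *)
Lemma type_preservingP g v : ~~ odd_dist v (g v) -> type_preserving g.
Proof.
move=> ov w; apply/same_typeP; rewrite (odd_dist_add w v) (odd_dist_add v (g v)).
by rewrite odd_dist_aut (negbTE ov) addFb (odd_dist_sym v w) addbb.
Qed.

Lemma type_preserving_odd g v : type_preserving g -> ~~ odd_dist v (g v).
Proof. by move=> /(_ v) /same_typeP. Qed.

Lemma elliptic_fix g : type_preserving g -> elliptic g -> exists v, g v = v.
Proof.
move=> tg [//|[v [w [vw E]]]].
have : [set v; w] (g v) by rewrite -E; left.
case=> /= gv; first by exists v.
have [a wE] := adj_neighbour vw.
have := type_preserving_odd v tg; rewrite gv wE odd_dist_sym odd_dist_neighbour.
by rewrite /odd_dist wordxx.
Qed.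

Section Build.
Variables (g h : T -> T) (tau tau' : T -> Omega -> Omega).
Hypotheses (gK : cancel g h) (hK : cancel h g).
Hypothesis gE : forall x a, g (nb x a) = nb (g x) (tau x a).
Hypothesis hE : forall x a, h (nb x a) = nb (h x) (tau' x a).

(** Colours name the neighbours, so [g] preserves adjacency as soon as it
    acts on the colours at every vertex; [h] gives the converse. *)
Lemma build_adj x y : adj (g x) (g y) = adj x y.
Proof.
apply/idP/idP => [/adj_neighbour [a E]|/adj_neighbour [a ->]].
  by rewrite -(gK y) E hE gK neighbour_adj.
by rewrite gE neighbour_adj.
Qed.

Lemma build_aut : exists2 k : Aut_tree T, k =1 g & forall x a, lp k x a = tau x a.
Proof.
exists (AutTree (Bijective gK hK) build_adj) => // x a.
by rewrite permE /local_fun /= gE colour_neighbour.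
Qed.
End Build.

(** In the coordinates given by words, [f] is applied letter by letter; all
    local permutations of this map are [f]. *)
Definition trans_fun v w f x := walk w (map f (word v x)).

Lemma trans_fun_walk v w f s : trans_fun v w f (walk v s) = walk w (map f s).
Proof. by rewrite /trans_fun word_walk -norm_map walk_norm. Qed.

Lemma trans_fun_nb v w f x a :
  trans_fun v w f (nb x a) = nb (trans_fun v w f x) (f a).
Proof.
by rewrite -(walk_word c v x) -walk_rcons !trans_fun_walk map_rcons walk_rcons.
Qed.

Lemma trans_funK v w f : cancel (trans_fun v w f) (trans_fun w v f^-1).
Proof.
move=> x; rewrite /trans_fun -/(trans_fun _ _ _ _) trans_fun_walk -map_comp.
by rewrite (eq_map (permK f)) map_id walk_word.
Qed.

Lemma trans_exists v w f : exists k : Aut_tree T,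
  k v = w /\ forall x, lp k x = f.
Proof.
have K := trans_funK w v f^-1; rewrite invgK in K.
have [k kE kl] := build_aut (trans_funK v w f) K (trans_fun_nb v w f)
  (trans_fun_nb w v f^-1).
exists k; split; first by rewrite kE (trans_fun_walk v w f [::]).
by move=> x; apply/permP => a; rewrite kl.
Qed.

End Auts.

(** * Permutation groups *)

Section Colours.
Variable A : finType.
Hypothesis A3 : (2 < #|A|)%N.
Implicit Types a b d : A.

Lemma other_colour a : exists b, b != a.
Proof.
have : (0 < #|[set~ a]%SET|)%N by rewrite cardsC1; case: #|A| A3 => [|[]].
by case/card_gt0P => b; rewrite !inE; exists b.
Qed.

Lemma third_colour a b : exists2 d, d != a & d != b.
Proof.
have : (0 < #|~: [set a; b]|)%N.
  rewrite cardsCs finset.setCK subn_gt0 (leq_ltn_trans _ A3) //.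
  by rewrite cards2; case: (a != b).
by case/card_gt0P => d; rewrite !inE negb_or => /andP [da db]; exists d.
Qed.
End Colours.

Section PermFacts.
Local Open Scope group_scope.
Variables (Omega : finType) (F : {group {perm Omega}}).
Implicit Types (a b d e : Omega) (f : {perm Omega}).

Lemma free_eq : freely_transitive F ->
  forall f f' a, f \in F -> f' \in F -> f a = f' a -> f = f'.
Proof.
move=> [_ Ffree] f f' a fF f'F E.
have : f * f'^-1 \in 'C_F[a | 'P].
  rewrite inE groupM ?groupV //=; apply/astab1P.
  by rewrite /= apermE permM E permK.
by rewrite Ffree => /set1P /eqP; rewrite -eq_mulgV1 => /eqP.
Qed.

Lemma trans_pt : [transitive F, on [set: Omega]%SET | 'P] ->
  forall a b, exists2 f, f \in F & f a = b.
Proof.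
move=> Ft a b.
have [|| f fF ->] := atransP2 Ft (x := a) (y := b); rewrite ?inE //.
by exists f.
Qed.

Lemma two_trans_trans : two_transitive F ->
  [transitive F, on [set: Omega]%SET | 'P].
Proof. exact: ntransitive1. Qed.

Lemma two_trans_stab : two_transitive F -> forall a b d, b != a -> d != a ->
  exists f, [/\ f \in F, f a = a & f b = d].
Proof.
move=> F2 a b d ba da.
have := stab_ntransitive (x := a) (ltn0Sn 0) (finset.in_setT a) F2.
move=> /(ntransitive1 (ltn0Sn 0)) /atransP2 /(_ b d).
rewrite !inE ba da => /(_ erefl erefl) [f + ->].
by rewrite inE => /andP [fF /astab1P fa]; exists f.
Qed.

(** The stabilisers of [a] and [b] together move [a] to every point, so [M]
    is transitive; as it contains the stabiliser of [a], it is the whole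
    group. *)
Lemma stabs_generate (M : {perm Omega} -> Prop) a b : two_transitive F ->
  (2 < #|Omega|)%N -> a != b ->
  (forall f f', M f -> M f' -> M (f * f')) ->
  (forall f, M f -> M f^-1) ->
  (forall f, f \in F -> f a = a -> M f) ->
  (forall f, f \in F -> f b = b -> M f) ->
  forall f, f \in F -> M f.
Proof.
move=> F2 Om3 ab MM MV Ma Mb f fF.
have [d da db] := third_colour Om3 a b.
have tra e : exists g, [/\ g \in F, M g & g a = e].
  have [->|eb] := eqVneq e b; last first.
    have [g [gF gb ga]] := two_trans_stab F2 ab eb.
    by exists g; split => //; apply: Mb.
  have [g [gF gb ga]] := two_trans_stab F2 ab db.
  have ba : b != a by rewrite eq_sym.
  have [h [hF ha hd]] := two_trans_stab F2 da ba.
  exists (g * h); split; first exact: groupM.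
    by apply: MM; [exact: Mb|exact: Ma].
  by rewrite permM ga hd.
have [g [gF Mg ga]] := tra (f a).
rewrite -(mulgKV g f); apply: MM => //; apply: Ma; rewrite ?groupM ?groupV //.
by rewrite permM -ga permK.
Qed.
End PermFacts.

(** * Elements with prescribed local permutations *)

Section Elements.
Local Open Scope group_scope.
Variables (Omega : finType) (T : tree) (c : legal_colouring Omega T).
Variables (F F' : {group {perm Omega}}).
Hypothesis sFF' : F \subset F'.
Hypothesis Fft : freely_transitive F.
Implicit Types (v w x y u : T) (a b d : Omega) (f s : {perm Omega}).
Local Notation nb := (neighbour c).
Local Notation word := (word c).
Local Notation walk := (walk c).
Local Notation branch := (branch c).
Local Notation lp := (local_perm c).
Local Notation G := (GFF_star_type c F F').
Implicit Types (g h k : G).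

Lemma GmulE g h x : (g * h) x = g (h x). Proof. by []. Qed.
Lemma GinvK g x : g^-1 (g x) = x. Proof. exact: aut_invK. Qed.
Lemma GKinv g x : g (g^-1 x) = x. Proof. exact: aut_Kinv. Qed.

Lemma G_ext g h : (forall x, g x = h x) -> g = h.
Proof. by move=> E; apply: val_inj; apply: aut_ext. Qed.

Lemma GP g : [/\ forall v, lp g v \in F', finite_set [set v | lp g v \notin F]
  & type_preserving g].
Proof. by have /asboolP [[]] := GFF_valP g. Qed.

Lemma mkG (k : Aut_tree T) v : (forall x, lp k x \in F') ->
  finite_set [set x | lp k x \notin F] -> ~~ odd_dist c v (k v) ->
  exists g : G, GFF_val g = k.
Proof.
move=> kF' kF ov.
have kG : k \in GFF_star c F F'.
  by apply/asboolP; split; [split|exact: type_preservingP ov].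
by exists (GFFStar kG).
Qed.

Lemma trans_G v w f : f \in F -> ~~ odd_dist c v w ->
  exists g : G, g v = w /\ forall x, lp g x = f.
Proof.
move=> fF ov; have [k [kv kl]] := trans_exists c v w f.
have [x|||g gE] := @mkG k v; rewrite ?kv //.
- by rewrite kl (fintype.subsetP sFF').
- rewrite (_ : mkset _ = set0) //; apply/seteqP; split=> // x /=.
  by rewrite kl fF.
- by exists g; rewrite gE.
Qed.

(** As [F] acts freely, a local permutation in [F] is determined by the
    image of one edge, and it determines the images of the other edges; so
    the values at one edge propagate through the half-tree. *)
Lemma rigid_branch (g h : Aut_tree T) v a : g v = h v -> g (nb v a) = h (nb v a) ->
  (forall x, branch v a x -> lp g x \in F /\ lp h x \in F) ->
  forall x, branch v a x -> g x = h x.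
Proof.
move=> gv gw gF x; have := word_reduced c v x; rewrite -{3 4}(walk_word c v x).
rewrite {1}/branch /=; case: (word v x) => //= d s + /eqP [da].
rewrite {d}da; elim: s v a gv gw gF {x} => [|b s IH] v a gv gw gF //.
rewrite reduced_cons => /andP [/= ba rs].
have ba' : b <> a by move=> E; rewrite E eqxx in ba.
have [wg wh] := gF _ (branch_neighbour c v a).
have E : lp g (nb v a) = lp h (nb v a).
  apply: (free_eq Fft (a := a)) => //.
  have : nb (g (nb v a)) (lp g (nb v a) a) = nb (h (nb v a)) (lp h (nb v a) a).
    by rewrite -!aut_neighbour neighbourK.
  by rewrite gw => /neighbour_inj.
rewrite /=; apply: IH => //; first by rewrite aut_neighbour gw E -aut_neighbour.
by move=> x bx; apply: gF; apply: (sub_branch ba').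
Qed.

Lemma fixes_branch (g : Aut_tree T) v a : g v = v -> g (nb v a) = nb v a ->
  (forall x, branch v a x -> lp g x \in F) -> forall x, branch v a x -> g x = x.
Proof.
move=> gv gw gF; apply: (@rigid_branch g 1) => // x /gF gx.
by rewrite local_perm1 group1.
Qed.

(** The building blocks of the rigid stabilisers. Such an element is
    determined by [s] and multiplicative in [s], because [F] acts freely. *)
Definition is_elem u s g := [/\ g u = u, lp g u = s & forall x, x <> u -> lp g x \in F].

Lemma is_elem_uniq u s g h : is_elem u s g -> is_elem u s h -> g = h.
Proof.
move=> [gu gs gF] [hu hs hF]; apply: G_ext => x.
have [->|[a bx]] := branch_cases c u x; first by rewrite gu hu.
apply: rigid_branch bx; rewrite ?gu ?hu // ?aut_neighbour ?gu ?gs ?hu ?hs //.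
by move=> y by_; split; [apply: gF|apply: hF] => E; rewrite E in by_; case: (branch_irr by_).
Qed.

Lemma is_elemM u s t g h : is_elem u s g -> is_elem u t h -> is_elem u (s * t) (h * g).
Proof.
move=> [gu gs gF] [hu hs hF]; split; first by rewrite GmulE gu.
  by rewrite local_permM gu gs hs.
move=> x xu; rewrite local_permM groupM ?gF ?hF // => E.
by apply: xu; apply: (aut_inj (g := g)); rewrite E.
Qed.

Lemma is_elemV u s g : is_elem u s g -> is_elem u s^-1 g^-1.
Proof.
move=> [gu gs gF]; have gu' : g^-1 u = u by rewrite -{1}gu GinvK.
split => //; first by rewrite local_permV gu' gs.
move=> x xu; rewrite local_permV groupV gF // => E.
by apply: xu; rewrite -(GKinv g x) E.
Qed.

Lemma is_elem1 u : is_elem u 1 1.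
Proof. by split=> // [|x _]; rewrite local_perm1. Qed.

Let tr a b : {perm Omega} := odflt 1 [pick f in F | f a == b].

Let trP a b : tr a b \in F /\ tr a b a = b.
Proof.
rewrite /tr; case: pickP => [f /andP [fF /eqP fa] //|].
by have [f fF fa] := trans_pt Fft.1 a b => /(_ f); rewrite fF fa eqxx.
Qed.

Let tr_comp a b d : tr a b * tr b d = tr a d.
Proof.
have [F1 E1] := trP a b; have [F2 E2] := trP b d; have [F3 E3] := trP a d.
by apply: (free_eq Fft (a := a)); rewrite ?groupM // permM E1 E2.
Qed.

Let tr1 a : tr a a = 1.
Proof. by have [F1 E1] := trP a a; apply: (free_eq Fft (a := a)); rewrite ?perm1. Qed.

Definition elem_fun u s x :=
  if word u x is d :: t then walk u (map (tr d (s d)) (d :: t)) else u.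

(** On the branch of colour [d] at [u] the automorphism below has constant
    local permutation, the element of [F] that agrees with [s] at [d]; hence
    only [u] can be singular. *)
Definition elem_perm u s x :=
  if word u x is d :: _ then tr d (s d) else s.

Let elem_permE u s d x : branch u d x -> elem_perm u s x = tr d (s d).
Proof. by rewrite /branch /elem_perm /=; case: (word u x) => //= e t /eqP [->]. Qed.

Let elem_funM u s t x : elem_fun u t (elem_fun u s x) = elem_fun u (s * t) x.
Proof.
rewrite /elem_fun; have := word_reduced c u x.
case: (word u x) => [|d r] rd; first by rewrite wordxx.
rewrite word_walk norm_map norm_reduced // map_cons (trP _ _).2.
rewrite permM; congr (walk _ _); rewrite !map_cons.
rewrite (trP _ _).2 (trP _ _).2; congr cons.
by rewrite -map_comp; apply: eq_map => b /=; rewrite -permM tr_comp.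
Qed.

Let elem_fun1 u x : elem_fun u 1 x = x.
Proof.
rewrite /elem_fun; case E: (word u x) => [|d r]; first by rewrite (word_nil E).
by rewrite perm1 tr1 -E (eq_map (@perm1 _)) map_id walk_word.
Qed.

Let elem_fun_nb u s x a : elem_fun u s (nb x a) =
  nb (elem_fun u s x) (elem_perm u s x a).
Proof.
have [->|[d bx]] := branch_cases c u x.
  rewrite /elem_fun /elem_perm wordxx (@word_walk_reduced _ _ c u [:: a]) //=.
  by rewrite (trP _ _).2.
have eb y : branch u d y -> elem_fun u s y = trans_fun c u u (tr d (s d)) y.
  by rewrite /branch /elem_fun /trans_fun /=; case: (word u y) => //= e t /eqP [->].
rewrite (eb x bx) (elem_permE s bx) -trans_fun_nb; have [/eb //|[-> ->]] := branch_step a bx.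
by rewrite neighbourK /elem_fun /trans_fun wordxx.
Qed.

Lemma elem_exists u s : s \in F' -> exists g, is_elem u s g.
Proof.
move=> sF'.
have K t : cancel (elem_fun u t) (elem_fun u t^-1).
  by move=> x; rewrite elem_funM mulgV elem_fun1.
have K' := K s^-1; rewrite invgK in K'.
have [k kE kl] := build_aut (K s) K' (elem_fun_nb u s) (elem_fun_nb u s^-1).
have ku : k u = u by rewrite kE /elem_fun wordxx.
have lpu : lp k u = s by apply/permP => a; rewrite kl /elem_perm wordxx.
have lpF x : x <> u -> lp k x \in F.
  have [->//|[d bx] _] := branch_cases c u x.
  rewrite (_ : lp k x = tr d (s d)); first exact: (trP _ _).1.
  by apply/permP => a; rewrite kl (elem_permE s bx).
have [x|||g gE] := @mkG k u.
- by have [->|/lpF/(fintype.subsetP sFF')//] := pselect (x = u); rewrite lpu.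
- apply: (@sub_finite_set _ _ [set u]) => // x /=.
  by have [//|/lpF ->] := pselect (x = u).
- by rewrite ku /odd_dist wordxx.
by exists g; split; rewrite gE.
Qed.

Lemma elem_fixes_branch u s g a x : is_elem u s g -> s a = a -> branch u a x -> g x = x.
Proof.
move=> [gu gs gF] sa; apply: fixes_branch => //.
  by rewrite aut_neighbour gs gu sa.
by move=> y by_; apply: gF => E; rewrite E in by_; case: (branch_irr by_).
Qed.

(** The rigid stabiliser of the half-tree [branch v a]. *)
Definition rist v a : set G := [set g | forall x, ~ branch v a x -> g x = x].

Definition fixator v a : set G := [set g | forall x, branch v a x -> g x = x].

Lemma rist_neighbour v a : rist (nb v a) a = fixator v a.
Proof.
apply/seteqP; split=> g gx x bx; apply: gx.
  by move/branchC; apply.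
by apply: contrapT => /branchC.
Qed.

Lemma rist_subgroup v a : is_subgroup (rist v a).
Proof.
split=> // [g h gr hr x bx|g gr x bx]; first by rewrite GmulE hr // gr.
by rewrite -{1}(gr x bx) GinvK.
Qed.

Lemma rist_pres v a g x : rist v a g -> branch v a x -> branch v a (g x).
Proof.
move=> gr bx; apply: contrapT => nb_; have := gr _ nb_.
by move/(aut_inj (g := g)) => E; rewrite E in nb_.
Qed.

Lemma rist_fix v a g : rist v a g -> g v = v /\ g (nb v a) = nb v a.
Proof.
move=> gr; have gv : g v = v by apply: gr; exact: branch_irr.
split => //; have := rist_pres gr (branch_neighbour c v a).
by rewrite aut_neighbour gv => b1; rewrite (branch_disj (branch_neighbour c v _) b1).
Qed.

Lemma sub_rist v a w b : branch w b `<=` branch v a -> rist w b `<=` rist v a.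
Proof. by move=> sb g gr x bx; apply: gr => /sb. Qed.

(** The two ends of an edge separate its two half-trees, so an element
    fixing both ends can be replaced by the identity on one side. *)
Lemma cut_exists g v a : g v = v -> g (nb v a) = nb v a ->
  exists k, [/\ forall x, branch v a x -> k x = g x, rist v a k
    & forall x, branch v a x -> lp k x = lp g x].
Proof.
move=> gv gw.
pose cf (h : Aut_tree T) x := if `[< branch v a x >] then h x else x.
have cfi (h : Aut_tree T) x : branch v a x -> cf h x = h x by rewrite /cf => /asboolT ->.
have cfo (h : Aut_tree T) x : ~ branch v a x -> cf h x = x by rewrite /cf => /asboolF ->.
have gb (h : Aut_tree T) x : h v = v -> h (nb v a) = nb v a -> branch v a x -> branch v a (h x).
  move=> hv hw bx; have := (branch_aut c h v a x).2 bx.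
  rewrite hv (_ : lp h v a = a) //.
  by apply: (@neighbour_inj _ _ c v); rewrite -{1}hv -aut_neighbour hw.
have gv' : g^-1 v = v by rewrite -{1}gv GinvK.
have gw' : g^-1 (nb v a) = nb v a by rewrite -{1}gw GinvK.
have K (h : Aut_tree T) : h v = v -> h (nb v a) = nb v a -> cancel (cf h) (cf h^-1).
  move=> hv hw x; have [bx|bx] := pselect (branch v a x); last by rewrite (cfo h x) // cfo.
  by rewrite (cfi h x) // cfi ?aut_invK //; exact: gb.
have E (h : Aut_tree T) : h v = v -> h (nb v a) = nb v a -> forall x b,
    cf h (nb x b) = nb (cf h x) ((if `[< branch v a x >] then lp h x else 1) b).
  move=> hv hw x b; case: asboolP => bx.
    rewrite (cfi h x) // -aut_neighbour.
    have [/cfi//|[-> ->]] := branch_step b bx.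
    by rewrite neighbourK hv cfo //; exact: branch_irr.
  rewrite (cfo h x) // perm1.
  have [by_|/cfo//] := pselect (branch v a (nb x b)).
  rewrite cfi //; have := branch_step b by_; rewrite neighbourK => -[//|[E1 E2]].
  by rewrite E1 hw.
have K' : cancel (cf g^-1) (cf g) by have := K g^-1 gv' gw'; rewrite (@invgK _ (GFF_val g)).
have [k kE kl] := build_aut (K g gv gw) K' (E g gv gw) (E g^-1 gv' gw').
have ki x : branch v a x -> lp k x = lp g x.
  by move=> bx; apply/permP => b; rewrite kl asboolT.
have ko x : ~ branch v a x -> lp k x = 1.
  by move=> bx; apply/permP => b; rewrite kl asboolF.
have [gF' gF _] := GP g.
have [x|||h hE] := @mkG k v.
- by have [/ki ->|/ko ->] := pselect (branch v a x).
- apply: sub_finite_set gF => x /=.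
  by have [/ki -> //|/ko ->] := pselect (branch v a x); rewrite group1.
- by rewrite kE cfo ?/odd_dist ?wordxx //; exact: branch_irr.
by exists h; split=> x bx; rewrite hE; [rewrite kE cfi|rewrite kE cfo|exact: ki].
Qed.

End Elements.

(** * Rigid stabilisers of half-trees are perfect *)

Section Rist.
Local Open Scope group_scope.
Variables (Omega : finType) (T : tree) (c : legal_colouring Omega T).
Variables (F F' : {group {perm Omega}}).
Hypothesis sFF' : F \subset F'.
Hypothesis Fft : freely_transitive F.
Hypothesis F'perf : perfect_point_stabilizers F'.
Implicit Types (v w x y u : T) (a b d : Omega) (f s : {perm Omega}).
Local Notation nb := (neighbour c).
Local Notation word := (word c).
Local Notation walk := (walk c).
Local Notation branch := (branch c).
Local Notation lp := (local_perm c).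
Local Notation G := (GFF_star_type c F F').
Local Notation rist := (@rist _ _ c F F').
Local Notation is_elem := (@is_elem _ _ c F F').
Implicit Types (g h k : G) (K : set G).

Lemma sing_bound g v :
  exists n, forall x, lp g x \notin F -> (size (word v x) <= n)%N.
Proof.
have [_ /finite_seqP [l lE] _] := GP g.
exists (\max_(x <- l) size (word v x)) => x xF.
apply: (@leq_bigmax_seq _ _ _ _ x) => //.
suff : [set` l] x by [].
by rewrite -lE.
Qed.

Lemma fix_pres (g : Aut_tree T) v b x : g v = v -> g (nb v b) = nb v b ->
  branch v b x -> branch v b (g x).
Proof.
move=> gv gw bx; have := (branch_aut c g v b x).2 bx.
rewrite gv (_ : lp g v b = b) //.
by apply: (@neighbour_inj _ _ c v); rewrite -{1}gv -aut_neighbour gw.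
Qed.

(** An element that fixes a vertex and its neighbours is the product of its
    restrictions to the branches at this vertex. *)
Lemma split_star K w g : is_subgroup K -> g w = w -> lp g w = 1 ->
  (forall b k, rist w b k -> (forall x, branch w b x -> k x = g x) ->
     (forall x, branch w b x -> lp k x = lp g x) -> K k) -> K g.
Proof.
move=> [K1 KM KV] gw glp Kcut.
have gnb b : g (nb w b) = nb w b by rewrite aut_neighbour gw glp perm1.
suff H (l : seq Omega) g' : g' w = w -> (forall b, g' (nb w b) = nb w b) ->
    (forall b x, b \notin l -> branch w b x -> g' x = x) ->
    (forall b x, b \in l -> branch w b x -> g' x = g x) -> K g'.
  apply: (H (enum Omega)) => // b x; first by rewrite mem_enum.
elim: l g' => [|b l IH] g' g'w g'nb g'o g'i.
  rewrite (_ : g' = 1) //; apply: G_ext => x.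
  by have [->//|[b bx]] := branch_cases c w x; apply: g'o bx.
have [bl|bl] := boolP (b \in l).
  apply: IH => // d x dl; last by apply: g'i; rewrite inE dl orbT.
  by apply: g'o; rewrite inE negb_or dl andbT; apply: contraNneq dl => ->.
have [k [kg kr klp]] := cut_exists gw (gnb b).
have krV : rist w b k^-1 by have [_ _] := rist_subgroup c F F' w b; apply.
have Kk : K k by apply: (Kcut b).
rewrite -(mulKVg k g'); apply: KM => //; apply: IH.
- by rewrite GmulE g'w krV //; exact: branch_irr.
- move=> d; rewrite GmulE g'nb.
  have [->|db] := eqVneq d b; first exact: (rist_fix krV).2.
  apply: krV => bd; move/eqP: db; apply.
  exact: branch_disj (branch_neighbour c w d) bd.
- move=> d x dl dx; rewrite GmulE.
  have [db|db] := eqVneq d b.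
    by rewrite db in dx; rewrite (g'i b) ?inE ?eqxx // -kg // GinvK.
  rewrite (g'o d) ?inE ?negb_or ?db // krV // => bx.
  by move/eqP: db; apply; exact: branch_disj dx bx.
- move=> d x dl dx; rewrite GmulE (g'i d) ?inE ?dl ?orbT // krV // => bx.
  have := fix_pres gw (gnb d) dx => dx'.
  by move: bl; rewrite -(branch_disj dx' bx) dl.
Qed.

(** By induction on the depth of the deepest vertex with local permutation
    outside [F]: an elementary element at the root of the half-tree cancels
    the local permutation there, and what remains splits over the smaller
    half-trees. *)
Lemma rist_gen K v a : is_subgroup K ->
  (forall u s e, branch v a u -> s \in F' -> is_elem u s e -> rist v a e -> K e) ->
  rist v a `<=` K.
Proof.
move=> Ksub + g; have [n] := sing_bound g v; have [K1 KM KV] := Ksub.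
move=> gn.
have {gn} : forall x, branch v a x -> lp g x \notin F -> (size (word v x) <= n)%N.
  by move=> x _; exact: gn.
elim: n v a g => [|n IH] v a g gn Kel gr.
  rewrite (_ : g = 1) //; apply: G_ext => x.
  have [bx|/gr//] := pselect (branch v a x).
  have [gv gw] := rist_fix gr.
  apply: (fixes_branch Fft gv gw) => // y by_.
  apply: contraT => /(gn _ by_); rewrite leqn0 size_eq0.
  by move: by_; rewrite /branch /=; case: (word v y).
have [gv gw] := rist_fix gr; pose w := nb v a.
have sF' : lp g w \in F' by have [->] := GP g.
have sa : lp g w a = a.
  rewrite local_perm_edge; apply: (@neighbour_inj _ _ c v).
  by rewrite -{1}gv -aut_neighbour gw.
have [e ee] := elem_exists c sFF' Fft w sF'.
have er : rist v a e.
  move=> x /branchC bx; exact: elem_fixes_branch ee sa bx.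
have [ew es eF] := ee.
have Ke : K e by apply: (Kel w _ _ (branch_neighbour c v a) sF' ee).
rewrite -(mulKVg e g); apply: (KM _ _ Ke).
have eV := is_elemV ee; have [ew' es' eF'] := eV.
apply: (@split_star K w) => //; first by rewrite GmulE gw ew'.
  by rewrite local_permM gw es' mulgV.
move=> b k kr kg klp.
have [ba|/eqP ba] := eqVneq b a.
  rewrite (_ : k = 1) //; apply: G_ext => x.
  have [bx|/kr//] := pselect (branch w b x).
  have nx : ~ branch v a x by apply/branchC; rewrite -/w -ba.
  rewrite kg // GmulE gr //.
  by apply: (elem_fixes_branch Fft eV) bx; rewrite ba -{1}sa permK.
apply: (IH w b k) => //; last first.
  move=> u s f bu sF f_el fr; apply: (Kel u s) => //; first exact: sub_branch ba _ bu.
  by apply: sub_rist fr; exact: sub_branch.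
move=> x bx; rewrite klp // local_permM => h.
have xF : lp g x \notin F.
  apply: contraNN h => gx; rewrite groupM // eF' // => E.
  have xw : x = w by apply: (aut_inj (g := g)); rewrite E gw.
  by rewrite xw in bx; case: (branch_irr bx).
have bax := sub_branch ba bx.
have := gn _ bax xF; rewrite word_neighbour /lmul; move: bax; rewrite /branch /= => ->.
by rewrite size_behead; case: (size _).
Qed.

Lemma branch_far v a u b x : branch v a u -> branch u b v ->
  ~ branch v a x -> branch u b x.
Proof.
move=> /branch_walk [s rs ->]; elim: s v a rs => [|e s IH] v a rs bv nx.
  suff -> : b = a by apply/branchC.
  by apply: (branch_disj bv); rewrite -{2}(neighbourK c v a); exact: branch_neighbour.
have := rs; rewrite reduced_cons => /andP [/= ea rs'].
apply: (IH (nb v a) e) => //; last first.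
  by apply: contra_not nx; apply: sub_branch => E; rewrite E eqxx in ea.
have [|[E ab]] := branch_step a bv; first by move=> H; exact: H.
have : word v (walk v [:: a, e & s]) = [:: a].
  have -> : walk v [:: a, e & s] = walk v [:: a].
    by rewrite -{1}(neighbourK c (walk v [:: a, e & s]) b) -E ab.
  by rewrite word_walk_reduced.
by rewrite word_walk_reduced.
Qed.

Lemma elem_rist v a u b s e : branch v a u -> branch u b v -> is_elem u s e ->
  s b = b -> rist v a e.
Proof.
move=> bu bv ee sb x bx; apply: (elem_fixes_branch Fft ee sb).
exact: branch_far bu bv bx.
Qed.

(** The elementary elements at a vertex form a copy of a point stabiliser of
    [F'], which is perfect, and they generate the rigid stabiliser. *)
Lemma rist_perfect K v a : is_subgroup K ->
  (forall g h, rist v a g -> rist v a h -> K (g * h * g^-1 * h^-1)) ->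
  rist v a `<=` K.
Proof.
move=> Ksub Kcom; apply: rist_gen => // u s e bu sF' ee er.
have [K1 KM KV] := Ksub.
have [b bv] : exists b, branch u b v.
  have [E|//] := branch_cases c u v.
  by rewrite E in bu; case: (branch_irr bu).
have sb : s b = b.
  have [eu es _] := ee; have := (branch_aut c e u b v).2 bv.
  by rewrite eu es (rist_fix er).1 => bv'; exact: branch_disj bv' bv.
pose C := 'C_F'[b | 'P].
have CP t : t \in C -> t \in F' /\ t b = b.
  by rewrite inE => /andP [tF /astab1P tb].
pose M := [set t in C | `[< forall h, is_elem u t h -> K h >]]%SET.
have MP t : (t \in M) = (t \in C) && `[< forall h, is_elem u t h -> K h >].
  by rewrite /M finset.in_set.
have gM : group_set M.
  apply/group_setP; split.
    by rewrite MP group1 /=; apply/asboolP => h /(is_elem_uniq Fft (is_elem1 c F F' u)) <-.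
  move=> t t'; rewrite !MP => /andP [tC /asboolP Kt] /andP [t'C /asboolP Kt'].
  rewrite groupM //=; apply/asboolP => h ff.
  have [f1 e1] := elem_exists c sFF' Fft u (CP _ tC).1.
  have [f2 e2] := elem_exists c sFF' Fft u (CP _ t'C).1.
  rewrite -(is_elem_uniq Fft (is_elemM e1 e2) ff).
  by apply: KM; [exact: Kt'|exact: Kt].
have sCM : C \subset (Group gM).
  rewrite /C -(F'perf b) derg1 gen_subG; apply/fintype.subsetP => _ /imset2P [t t' tC t'C ->].
  rewrite [_ \in _]MP groupR //=; apply/asboolP => h ff.
  have [f1 e1] := elem_exists c sFF' Fft u (CP _ tC).1.
  have [f2 e2] := elem_exists c sFF' Fft u (CP _ t'C).1.
  have := is_elemM (is_elemM (is_elemM (is_elemV e1) (is_elemV e2)) e1) e2.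
  have -> : t^-1 * t'^-1 * t * t' = [~ t, t'] by rewrite commgEl conjgE !mulgA.
  move=> /(is_elem_uniq Fft ff) ->; rewrite !mulgA; apply: Kcom; apply: (elem_rist bu bv); eauto.
    exact: (CP _ t'C).2.
  exact: (CP _ tC).2.
have sC : s \in C by rewrite inE sF'; apply/astab1P.
have := fintype.subsetP sCM s sC; rewrite [_ \in _]MP => /andP [_ /asboolP]; exact.
Qed.
End Rist.

(** * Ends as infinite reduced words *)

Section Cofinal.
Local Open Scope group_scope.
Variable T : tree.
Implicit Types (r s t : nat -> T) (xi eta : tree_end T).

Lemma cofinal_refl r : cofinal r r.
Proof. by exists 0%N, 0%N. Qed.

Lemma cofinal_sym r s : cofinal r s -> cofinal s r.
Proof. by move=> [m [n E]]; exists n, m => k; rewrite E. Qed.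

Lemma cofinal_trans r s t : cofinal r s -> cofinal s t -> cofinal r t.
Proof.
move=> [m [n E]] [m' [n' E']]; exists (m + m')%N, (n' + n)%N => k.
by rewrite -addnA E addnCA E' addnA.
Qed.

Lemma end_mem xi r : end_rays xi r -> forall s, end_rays xi s <-> is_ray s /\ cofinal r s.
Proof.
have [t [_ ->]] := end_raysP xi; move=> [rr tr] s; split=> -[rs].
  by move=> ts; split=> //; exact: cofinal_trans (cofinal_sym tr) ts.
by move=> rs'; split=> //; exact: cofinal_trans tr rs'.
Qed.

Lemma end_ray xi r : end_rays xi r -> is_ray r.
Proof. by move=> h; have /(end_mem h) [] := h. Qed.

Lemma end_cofinal xi r s : end_rays xi r -> end_rays xi s -> cofinal r s.
Proof. by move=> h /(end_mem h) []. Qed.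

Lemma end_eq xi eta r : end_rays xi r -> end_rays eta r -> xi = eta.
Proof.
move=> h h'; apply: end_ext; apply/seteqP; split=> s.
  by move=> /(end_mem h) /(end_mem h').
by move=> /(end_mem h') /(end_mem h).
Qed.

Lemma end_nonempty xi : exists r, end_rays xi r.
Proof.
have [r [rr E]] := end_raysP xi; exists r; rewrite E; split=> //.
exact: cofinal_refl.
Qed.

Lemma end_of_ray r : is_ray r -> exists xi : tree_end T, end_rays xi r.
Proof.
move=> rr; have P : exists r0, is_ray r0 /\
   [set s | is_ray s /\ cofinal r s] = [set s | is_ray s /\ cofinal r0 s].
  by exists r.
by exists (TreeEnd P); split=> //; exact: cofinal_refl.
Qed.
End Cofinal.

Section Ends.
Local Open Scope group_scope.
Variables (Omega : finType) (T : tree) (c : legal_colouring Omega T).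
Implicit Types (v w x y u : T) (s : seq Omega) (a b d : Omega).
Implicit Types (p q : nat -> Omega) (xi eta : tree_end T) (g : Aut_tree T).
Local Notation nb := (neighbour c).
Local Notation word := (word c).
Local Notation walk := (walk c).
Local Notation branch := (branch c).
Local Notation lp := (local_perm c).

Definition ireduced p := forall n, p n != p n.+1.
Definition iwalk v p n := walk v (mkseq p n).

Lemma iwalkS v p n : iwalk v p n.+1 = nb (iwalk v p n) (p n).
Proof. by rewrite /iwalk mkseqS walk_rcons. Qed.

Lemma reduced_mkseq p n : ireduced p -> reduced (mkseq p n).
Proof.
move=> ip; apply/(sortedP (p 0%N)) => i; rewrite size_mkseq => h.
by rewrite !nth_mkseq // ltnW.
Qed.

Lemma word_iwalk v p n : ireduced p -> word v (iwalk v p n) = mkseq p n.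
Proof. by move=> ip; rewrite word_walk_reduced //; exact: reduced_mkseq. Qed.

Lemma is_ray_iwalk v p : ireduced p -> is_ray (iwalk v p).
Proof.
move=> ip; split=> [m n /(congr1 (fun x => size (word v x)))|n].
  by rewrite !word_iwalk // !size_mkseq.
by rewrite iwalkS neighbour_adj.
Qed.

Lemma ray_iwalk r : is_ray r ->
  ireduced (fun n => c (r n) (r n.+1)) /\
  r = iwalk (r 0%N) (fun n => c (r n) (r n.+1)).
Proof.
move=> [ri ra]; split=> [n|].
  apply/eqP => E; have : nb (nb (r n) (c (r n) (r n.+1))) (c (r n.+1) (r n.+2)) = r n.
    by rewrite -E neighbourK.
  by rewrite !neighbour_colour // => /ri /eqP; rewrite eqn_leq ltnNge leqnSn.
apply/funext; elim=> [//|n IH]; rewrite iwalkS -IH neighbour_colour //.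
Qed.

Definition icons d p n := if n is m.+1 then p m else d.

Lemma iwalk_cons u d p n : iwalk (nb u d) (icons d p) n.+1 = iwalk u p n.
Proof.
elim: n => [|n IH]; first by rewrite iwalkS /iwalk /= neighbourK.
by rewrite iwalkS IH [RHS]iwalkS.
Qed.

Lemma iwalk_shift u p n : iwalk (nb u (p 0%N)) (p \o succn) n = iwalk u p n.+1.
Proof.
elim: n => [|n IH]; first by rewrite iwalkS.
by rewrite iwalkS IH [RHS]iwalkS.
Qed.

(** Moving the base point to a neighbour removes the first colour of the ray
    if the ray runs through it, and adds a colour in front otherwise. *)
Lemma end_base_step xi u d p : ireduced p -> end_rays xi (iwalk u p) ->
  exists2 q, ireduced q & end_rays xi (iwalk (nb u d) q).
Proof.
move=> ip xip; have [E|pd] := eqVneq (p 0%N) d.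
  exists (p \o succn); first by move=> n; exact: ip.
  apply/(end_mem xip); split; first by apply: is_ray_iwalk => n; exact: ip.
  by exists 1%N, 0%N => k; rewrite -E iwalk_shift.
have ic : ireduced (icons d p) by case=> [|n] /=; [rewrite eq_sym|exact: ip].
exists (icons d p) => //; apply/(end_mem xip); split; first exact: is_ray_iwalk.
by exists 0%N, 1%N => k; rewrite [(1 + k)%N]add1n iwalk_cons.
Qed.

Lemma end_base xi v : exists p, ireduced p /\ end_rays xi (iwalk v p).
Proof.
have [r xir] := end_nonempty xi; have [ip E] := ray_iwalk (end_ray xir).
have : exists p, ireduced p /\ end_rays xi (iwalk (r 0%N) p).
  by eexists; split; [exact: ip|rewrite -E].
rewrite -(walk_word c (r 0%N) v); move: (r 0%N) (word _ _) => u s {xir ip E r v}.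
elim: s u => //= a s IH u [p [ip xip]]; apply: IH.
by have [q iq xiq] := end_base_step a ip xip; exists q.
Qed.

(** The colours along the ray from a vertex to an end. *)
Definition eword xi v : nat -> Omega := projT1 (cid (end_base xi v)).
Definition eray xi v : nat -> T := iwalk v (eword xi v).
Definition edir v xi : Omega := eword xi v 0%N.

Lemma eword_reduced xi v : ireduced (eword xi v).
Proof. by rewrite /eword; case: cid => p []. Qed.

Lemma end_eray xi v : end_rays xi (eray xi v).
Proof. by rewrite /eray /eword; case: cid => p []. Qed.

Lemma iwalk_cofinal_inj v p q : ireduced p -> ireduced q ->
  cofinal (iwalk v p) (iwalk v q) -> p = q.
Proof.
move=> ip iq [m [n E]].
have E' k : mkseq p (m + k) = mkseq q (n + k).
  by rewrite -(word_iwalk v _ ip) E word_iwalk.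
have mn : m = n by have := congr1 size (E' 0%N); rewrite !size_mkseq !addn0.
apply/funext => i; have := congr1 (fun s => nth (p 0%N) s i) (E' i.+1).
by rewrite -mn !nth_mkseq // addnS ltnS leq_addl.
Qed.

Lemma eword_uniq xi v p : ireduced p -> end_rays xi (iwalk v p) -> eword xi v = p.
Proof.
move=> ip xip; apply: (@iwalk_cofinal_inj v) => //; first exact: eword_reduced.
exact: end_cofinal (end_eray xi v) xip.
Qed.

Lemma end_of_word v p : ireduced p -> exists xi, eword xi v = p.
Proof.
move=> ip; have [xi xip] := end_of_ray (is_ray_iwalk v ip).
by exists xi; exact: eword_uniq.
Qed.

Lemma erayS xi v n : eray xi v n.+1 = nb (eray xi v n) (eword xi v n).
Proof. exact: iwalkS. Qed.

Lemma eword_eray xi v n k : eword xi (eray xi v n) k = eword xi v (n + k).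
Proof.
have E j : iwalk (eray xi v n) (fun k => eword xi v (n + k)) j = eray xi v (n + j).
  elim: j => [|j IH]; first by rewrite addn0.
  by rewrite iwalkS IH addnS erayS.
have ip : ireduced (fun k => eword xi v (n + k)).
  by move=> j; rewrite addnS; exact: eword_reduced.
rewrite (@eword_uniq _ _ _ ip) //.
apply/(end_mem (end_eray xi v)); split; first exact: is_ray_iwalk.
by exists n, 0%N => j; rewrite E.
Qed.

Lemma edir_eray xi v n : edir (eray xi v n) xi = eword xi v n.
Proof. by rewrite /edir eword_eray addn0. Qed.

Lemma eword_inj v xi eta : eword xi v = eword eta v -> xi = eta.
Proof.
by move=> E; apply: (end_eq (end_eray xi v)); rewrite /eray E; exact: end_eray.
Qed.

Lemma edir_sep xi eta : (forall u, edir u xi = edir u eta) -> xi = eta.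
Proof.
move=> E; have [v] := tree_inhabited T.
have Er n : eray xi v n = eray eta v n /\ eword xi v n = eword eta v n.
  elim: n => [|n [IH1 IH2]]; first by split=> //; exact: E.
  have E1 : eray xi v n.+1 = eray eta v n.+1 by rewrite !erayS IH1 IH2.
  by split=> //; rewrite -!edir_eray E1.
by apply: (@eword_inj v); apply/funext => n; have [_] := Er n.
Qed.

(** The decreasing half-trees cut off by the edges of the ray towards an end. *)
Definition tail xi v n := branch (eray xi v n) (eword xi v n).

Lemma tailS xi v n : tail xi v n.+1 `<=` tail xi v n.
Proof.
rewrite /tail erayS; apply: sub_branch; apply/eqP; rewrite eq_sym.
exact: eword_reduced.
Qed.

Lemma tail_decr xi v m n : (m <= n)%N -> tail xi v n `<=` tail xi v m.
Proof.
move=> /subnKC <-; elim: (n - m)%N => [|k IH]; first by rewrite addn0.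
by rewrite addnS; apply: subset_trans IH; exact: tailS.
Qed.

Lemma eray_tail xi v n : tail xi v n (eray xi v n.+1).
Proof. by rewrite erayS; exact: branch_neighbour. Qed.

Lemma eray_branch xi v n : branch v (edir v xi) (eray xi v n.+1).
Proof. exact: (@tail_decr xi v 0%N n) (eray_tail xi v n). Qed.

Lemma eray_cofinal xi u v : exists k l, forall n,
  eray xi u (k + n) = eray xi v (l + n) /\ eword xi u (k + n) = eword xi v (l + n).
Proof.
have [k [l E]] := end_cofinal (end_eray xi u) (end_eray xi v).
by exists k, l => n; split=> //; rewrite -!edir_eray E.
Qed.

Lemma tail_sub xi v u :
  exists N, forall n, (N <= n)%N -> tail xi v n `<=` branch u (edir u xi).
Proof.
have [k [l E]] := eray_cofinal xi v u.
exists k => n /subnKC <-; have [E1 E2] := E (n - k)%N.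
by rewrite /tail E1 E2; exact: (@tail_decr xi u 0%N).
Qed.

Lemma edir_branch r xi v a N : end_rays xi r -> (forall k, (N <= k)%N -> branch v a (r k)) ->
  edir v xi = a.
Proof.
move=> xir bN; have [m [n E]] := end_cofinal xir (end_eray xi v).
have := bN (m + N.+1)%N; rewrite E [(n + _)%N]addnS => h.
apply: (branch_disj (eray_branch xi v (n + N))); apply: h.
by rewrite addnS ltnW // ltnS leq_addl.
Qed.

Lemma edir_sub v a u b xi : branch v a `<=` branch u b -> edir v xi = a ->
  edir u xi = b.
Proof.
move=> sb E; apply: (@edir_branch _ _ _ _ 1%N (end_eray xi v)) => -[|k] // _.
by apply: sb; rewrite -E; exact: eray_branch.
Qed.

Lemma half_treeP v w u : adj v w -> half_tree v w u <-> branch v (c v w) u.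
Proof.
move=> vw; have [a ->] := adj_neighbour c vw; rewrite colour_neighbour => {w vw}.
split=> [[p [pp <- vp]]|].
  move: vp; rewrite inE negb_or => /andP [_].
  move: (nb v a) (branch_neighbour c v a) pp => w; elim: p w => //= x p IH w bw.
  move=> /andP [/(adj_neighbour c) [d ->] pp]; rewrite inE negb_or => /andP [vx vp].
  apply: IH => //; have [//|[E1 E2]] := branch_step d bw.
  by move: vx; rewrite E1 E2 neighbourK eqxx.
move=> /branch_walk [s rs ->]; exists (scanl nb (nb v a) s); split.
- exact: path_walk.
- exact: last_scanl_walk.
- suff H x : x \in nb v a :: scanl nb (nb v a) s -> branch v a x.
    by apply/negP => /H /branch_irr.
  elim: s v a rs x => [|e s IH] v a; rewrite reduced_cons => /andP [ea rs] x.
    by rewrite inE => /eqP ->; exact: branch_neighbour.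
  rewrite inE => /orP [/eqP ->|]; first exact: branch_neighbour.
  move=> /(IH _ _ rs); apply: sub_branch => E.
  by rewrite /= E eqxx in ea.
Qed.

Lemma shadowP v w xi : adj v w -> shadow v w xi <-> edir v xi = c v w.
Proof.
move=> vw; split=> [[r xir [N _ rN]]|E].
  apply: (edir_branch (N := N) xir) => k /rN; exact: (half_treeP _ vw).1.
exists (eray xi v); first exact: end_eray.
exists 1%N => // -[|k] //= _; apply/half_treeP => //; rewrite -E.
exact: eray_branch.
Qed.

Lemma shadow_neighbour v a : shadow v (nb v a) = [set xi | edir v xi = a].
Proof.
apply/seteqP; split=> xi /=; rewrite shadowP ?neighbour_adj // colour_neighbour //.
Qed.

Lemma open_edir v a : open [set xi | edir v xi = a].
Proof.
rewrite -shadow_neighbour.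
exists [set shadow v (nb v a)]; last by rewrite bigcup_set1.
move=> _ ->; exists [fset (shadow v (nb v a))]%fset.
  move=> _ /fset1P ->; apply/mem_set; exists v, (nb v a); split=> //.
  exact: neighbour_adj.
by apply/seteqP; split=> xi /= h; [apply: h; exact/fset1P|move=> _ /fset1P ->].
Qed.

(** The neighbourhoods of an end, written with the basis of half-trees
    around it. *)
Definition near_end xi (P : set (tree_end T)) :=
  exists u, forall eta, edir u eta = edir u xi -> P eta.

Lemma near_tail xi P v : near_end xi P -> exists N, forall n eta, (N <= n)%N ->
  edir (eray xi v n) eta = eword xi v n -> P eta.
Proof.
move=> [u uP]; have [N NP] := tail_sub xi v u; exists N => n eta /NP sb E.
by apply: uP; exact: edir_sub sb E.
Qed.

Lemma nearI xi P Q : near_end xi P -> near_end xi Q -> near_end xi (P `&` Q).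
Proof.
have [v] := tree_inhabited T => /(near_tail v) [m mP] /(near_tail v) [n nQ].
exists (eray xi v (maxn m n)) => eta; rewrite edir_eray => E.
by split; [apply: mP E|apply: nQ E]; rewrite leq_max leqnn ?orbT.
Qed.

(** A half-tree around an end contains all far tails of a ray to it, so a
    finite intersection of such half-trees contains one of them. *)
Lemma nbhs_near xi P : nbhs xi P <-> near_end xi P.
Proof.
split=> [|[u uP]]; last first.
  have := open_nbhs_nbhs (conj (open_edir u (edir u xi)) (erefl (edir u xi))).
  by apply: filterS => eta /= /uP.
rewrite nbhsE => -[A [[D sD DA] Axi] AP].
have : near_end xi A; last by move=> [u uA]; exists u => eta /uA /AP.
rewrite -DA in Axi *; have [B DB Bxi] := Axi; have [E sE EB] := sD _ DB.
have : near_end xi B; last by move=> [u uA]; exists u => eta /uA; exists B.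
rewrite -EB in Bxi *.
have [v] := tree_inhabited T.
have H A' : A' \in E -> near_end xi A'.
  move=> AE; have /set_mem [x [w [xw A'E]]] := sE _ AE.
  have := Bxi _ AE; rewrite /= A'E => /(shadowP _ xw) h.
  by exists x => eta; rewrite h => /(shadowP _ xw).
have : near_end xi (fun eta => forall A', A' \in (enum_fset E) -> A' eta).
  have : {subset enum_fset E <= E} by [].
  elim: (enum_fset E) => [_|A' l IH sl]; first by exists v.
  have [||u uP] := nearI (H A' _) (IH _).
  - by apply: sl; rewrite inE eqxx.
  - by move=> B' B'l; apply: sl; rewrite inE B'l orbT.
  by exists u => eta /uP [h1 h2] B'; rewrite inE => /orP [/eqP ->|/h2].
by move=> [u uP]; exists u => eta /uP h A'; exact: h.
Qed.

Lemma near_sep xi eta : xi <> eta -> exists u, edir u xi <> edir u eta.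
Proof.
move=> h; apply: contrapT => /forallNP h'; apply: h; apply: edir_sep => u.
by apply: contrapT; exact: h'.
Qed.

Lemma eray_act g xi v n : eray (end_act g xi) (g v) n = g (eray xi v n).
Proof.
have rr : end_rays (end_act g xi) (g \o eray xi v) by exists (eray xi v) => //; exact: end_eray.
have [ip E] := ray_iwalk (end_ray rr).
rewrite /eray (eword_uniq (v := g v) ip) ?[in RHS]/=.
  by rewrite -[LHS]/(iwalk ((g \o eray xi v) 0%N) _ _) -E.
by have := rr; rewrite {1}E.
Qed.

Lemma eword_act g xi v n :
  eword (end_act g xi) (g v) n = lp g (eray xi v n) (eword xi v n).
Proof.
have := eray_act g xi v n.+1; rewrite !erayS aut_neighbour eray_act.
by move/neighbour_inj.
Qed.

Lemma edir_act g xi v : edir (g v) (end_act g xi) = lp g v (edir v xi).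
Proof. exact: eword_act. Qed.

(** Compactness of the space of ends: an ultrafilter chooses a direction at
    every vertex, and following these directions never backtracks. *)
Lemma ends_ultra (F : set_system (tree_end T)) : UltraFilter F ->
  exists xi, forall P, near_end xi P -> F P.
Proof.
move=> FU; have [v0] := tree_inhabited T.
have dirE v : exists a, F [set xi | edir v xi = a].
  apply: contrapT => /forallNP h.
  suff : F (fun xi => forall a, a \in enum Omega -> edir v xi <> a).
    by move/filter_ex => -[xi /(_ (edir v xi))]; rewrite mem_enum; exact.
  elim: (enum Omega) => [|a l IH]; first by apply: filterS filterT.
  have [//|na] := in_ultra_setVsetC [set xi | edir v xi = a] FU.
    by move=> /h.
  apply: filterS (filterI na IH) => xi [h1 h2] b; rewrite inE => /orP [/eqP ->//|].
  exact: h2.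
pose dir v := projT1 (cid (dirE v)).
have dirP v : F [set xi | edir v xi = dir v] by rewrite /dir; case: cid.
pose x n := iter n (fun v => nb v (dir v)) v0.
pose p n := dir (x n).
have ip : ireduced p.
  move=> n; apply/eqP => E.
  have FI : F ([set xi | edir (x n) xi = dir (x n)] `&`
      [set xi | edir (x n.+1) xi = dir (x n.+1)]) by exact: filterI.
  have [xi [h1' h2']] := filter_ex FI.
  have h1 : edir (x n) xi = dir (x n) := h1'.
  have h2 : edir (x n.+1) xi = dir (x n.+1) := h2'.
  have xE : x n.+1 = eray xi (x n) 1%N by rewrite erayS -/(edir _ _) h1.
  move: h2; rewrite xE edir_eray -xE => h2.
  have := eword_reduced xi (x n) 0%N; rewrite h2 -[eword _ _ _]/(edir _ _) h1.
  by rewrite -/(p n) -/(p n.+1) E eqxx.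
have [xi xiE] := end_of_word v0 ip.
have xE n : eray xi v0 n = x n.
  by elim: n => // n IH; rewrite erayS IH xiE.
exists xi => P /(near_tail v0) [N /(_ N _ (leqnn _)) NP].
by apply: filterS (dirP (x N)) => eta /= E; apply: NP; rewrite xE E xiE.
Qed.

End Ends.

(** * The compact space of subgroups *)

Section SubSpaceTopology.
Local Open Scope group_scope.
Variable G : groupType.
Implicit Types (H K : sub_space G) (D : seq G) (U : set (sub_space G)).

Definition agree D H K := forall g, g \in D -> (sub_set K g <-> sub_set H g).

Lemma nbhs_mem H g : nbhs H [set K | sub_set K g <-> sub_set H g].
Proof.
have cont : continuous (fun K : sub_space G => sub_indicator K g).
  have c1 : continuous (@sub_indicator G : sub_space G -> prod_topology (fun=> bool)).
    exact: (@initial_continuous _ _ (@sub_indicator G)).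
  have c2 : continuous (fun f : prod_topology (fun _ : G => bool) => f g).
    exact: (@proj_continuous _ (fun=> bool)).
  by move=> K; exact: (@continuous_comp _ _ _ _ _ K (c1 K) (c2 _)).
have : nbhs H [set K | sub_indicator K g = sub_indicator H g].
  exact: cont H _ (discrete_set1 (sub_indicator H g)).
move=> h; apply: filterS h => K /= E; rewrite /sub_indicator in E.
by split=> /asboolP; [rewrite E|rewrite -E] => /asboolP.
Qed.

Lemma nbhs_agree H D : nbhs H (agree D H).
Proof.
elim: D => [|g D IH]; first by apply: filterS filterT.
apply: filterS (filterI (nbhs_mem H g) IH) => K [h1 h2] h.
by rewrite inE => /orP [/eqP ->|/h2].
Qed.

(** The topology of pointwise convergence compares subgroups on finite sets. *)
Lemma sub_nbhsP H (A : set (sub_space G)) :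
  nbhs H A <-> exists D, agree D H `<=` A.
Proof.
split=> [|[D DA]]; last exact: filterS DA (nbhs_agree H D).
rewrite nbhsE => -[B [[C oC CB] BH] BA].
pose F : set_system (prod_topology (fun _ : G => bool)) :=
  filter_from setT (fun D => [set f | forall g, g \in D -> f g = sub_indicator H g]).
have FF : Filter F.
  apply: filter_from_filter; first by exists [::].
  move=> D D' _ _; exists (D ++ D') => // f h.
  by split=> g gD; apply: h; rewrite mem_cat gD ?orbT.
have cvF : F --> sub_indicator H.
  apply/cvg_sup => g A'; rewrite nbhsE => -[B' [[C' _ <-] B'H] B'A].
  exists [:: g] => // f /(_ g); rewrite inE eqxx => /(_ erefl) E.
  by apply: B'A; rewrite /= E.
have : F C by apply: cvF; apply: open_nbhs_nbhs; split=> //; move: BH; rewrite -CB.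
case=> D _ DC; exists D => K DK; apply: BA; rewrite -CB; apply: DC => g gD.
by apply/idP/idP => /asboolP /(DK g gD) /asboolP.
Qed.

Lemma sub_closureP U H : closure U H <-> forall D, exists2 K, U K & agree D H K.
Proof.
split=> [cH D|h A /sub_nbhsP [D DA]].
  by have [K [UK KD]] := cH _ (nbhs_agree H D); exists K.
by have [K UK /DA] := h D; exists K.
Qed.

Lemma sub_closedP U : closed U <-> forall H, (forall D, exists2 K, U K & agree D H K) -> U H.
Proof.
split=> [cU H /sub_closureP|h H /sub_closureP]; [exact: cU|exact: h].
Qed.

Lemma sub_sing_closed H : closed [set H].
Proof.
apply/sub_closedP => K h; apply: sub_space_ext; apply/seteqP; split=> g.
  by have [_ -> /(_ g)] := h [:: g]; rewrite inE eqxx => /(_ erefl) [].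
by have [_ -> /(_ g)] := h [:: g]; rewrite inE eqxx => /(_ erefl) [].
Qed.

(** Compactness of the space of subgroups: the elements belonging to almost
    all subgroups form a subgroup. *)
Lemma sub_ultra (F : set_system (sub_space G)) : UltraFilter F ->
  exists H, (forall g, F [set K | sub_set K g <-> sub_set H g]) /\ F --> H.
Proof.
move=> FU; pose L : set G := [set g | F [set K | sub_set K g]].
have L_sub : is_subgroup L.
  split; first by apply: filterS filterT => K _; case: (Defs.sub_setP K).
  - move=> x y Lx Ly; apply: filterS (filterI Lx Ly) => K [Kx Ky].
    by have [_ KM _] := Defs.sub_setP K; exact: KM.
  - move=> x; apply: filterS => K Kx.
    by have [_ _ KV] := Defs.sub_setP K; exact: KV.
have H g : F [set K | sub_set K g <-> sub_set (SubSpace L_sub) g].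
  have [Fg|Fg] := in_ultra_setVsetC [set K | sub_set K g] FU.
    by apply: filterS (Fg) => K Kg; split=> // _.
  apply: filterS (Fg) => K Kg; split=> // Lg.
  by have [K' []] := filter_ex (filterI Fg Lg).
exists (SubSpace L_sub); split=> // A /sub_nbhsP [D DA].
suff : F (agree D (SubSpace L_sub)) by apply: filterS.
elim: D {DA} => [|g D IH]; first by apply: filterS filterT.
apply: filterS (filterI (H g) IH) => K [h1 h2] h.
by rewrite inE => /orP [/eqP ->|/h2].
Qed.

(** Compactness, in the form used to pass to the limit in a sequence of
    conjugates. *)
Lemma sub_limit U (K : nat -> sub_space G) : closed U -> (forall n, U (K n)) ->
  exists2 H, U H & forall g, (exists N, forall n, (N <= n)%N -> sub_set (K n) g) ->
    sub_set H g.
Proof.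
move=> cU UK; have [V [VU sV]] := @ultraFilterLemma _ (K @ \oo) _.
have [H [Hg cvH]] := sub_ultra VU; exists H.
  apply: cU => A HA; have VU' : V U by apply: sV; exists 0%N => // n _; exact: UK.
  by have [H' [h1 h2]] := filter_ex (filterI (cvH _ HA) VU'); exists H'.
move=> g [N NK]; have VN : V [set L | sub_set L g] by apply: sV; exists N.
by have [L [/= h1 h2]] := filter_ex (filterI (Hg g) VN); apply/h1.
Qed.

(** A neighbourhood of the trivial subgroup that avoids [U] is described by
    a finite set of elements. *)
Lemma confined U : closed U -> ~ U (SubSpace (trivial_is_subgroup G)) ->
  exists D : seq G, (forall g, g \in D -> g <> 1) /\
    forall K, U K -> exists2 g, g \in D & sub_set K g.
Proof.
move=> cU nU; apply: contrapT => h; apply: nU; apply: ((sub_closedP U).1 cU) => D.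
apply: contrapT => h'; apply: h; exists [seq g <- D | g != 1]; split.
  by move=> g; rewrite mem_filter => /andP [/eqP].
move=> K UK; apply: contrapT => h''; apply: h'; exists K => // g gD /=.
split=> [Kg|->]; last by case: (Defs.sub_setP K).
by apply: contrapT => g1; apply: h''; exists g => //; rewrite mem_filter gD andbT; apply/eqP.
Qed.

End SubSpaceTopology.

(** * Stabilisers of ends *)

Section Squares.
Definition is_square n := [exists k : 'I_n.+1, k * k == n]%N.

Lemma is_square_sqr n : is_square (n * n).
Proof.
apply/existsP; have h : (n < (n * n).+1)%N by rewrite ltnS; case: n => // n; rewrite leq_pmulr.
by exists (Ordinal h) => /=.
Qed.

Lemma is_square_gap n m : (n * n < m < n.+1 * n.+1)%N -> is_square m = false.
Proof.
move=> /andP [h1 h2]; apply/existsP => -[[k hk] /= /eqP E]; rewrite -E in h1 h2.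
have kn : (n < k)%N by rewrite ltnNge; apply/negP => kn; rewrite ltnNge leq_mul in h1.
by rewrite ltnNge leq_mul in h2.
Qed.

(** The odd terms mark the squares among the natural numbers, whose gaps
    grow, so the sequence is not eventually periodic. *)
Definition square_seq (A : Type) (x y z : A) n :=
  if odd n then (if is_square n./2 then y else z) else x.

(** The shift is even to preserve parity; after the square of [m = N + L],
    the next [L] numbers are not squares. *)
Lemma square_seq_aperiodic (A : Type) (x y z : A) : y <> z ->
  forall L N, (0 < L)%N -> exists2 n, (N <= n)%N &
    square_seq x y z (n + L.*2) <> square_seq x y z n.
Proof.
move=> yz L N L0; pose m := (N + L)%N; exists (m * m).*2.+1.
  rewrite ltnW // ltnS -addnn (leq_trans (leq_addr L N)) // -/m.
  by case: (m) => // k; rewrite (leq_trans _ (leq_addr _ _)) // leq_pmulr.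
rewrite /square_seq addSn -doubleD /= !odd_double /= !uphalf_double.
rewrite is_square_sqr (@is_square_gap m); first by move=> E; apply: yz.
rewrite -{1}[(m * m)%N]addn0 ltn_add2l L0 /= mulSn mulnS addSn ltnS.
by rewrite addnA [leqRHS]addnC leq_add2l (leq_trans (leq_addl N L)) // leq_addr.
Qed.
End Squares.

Section Stabilisers.
Local Open Scope group_scope.
Variables (Omega : finType) (T : tree) (c : legal_colouring Omega T).
Variables (F F' : {group {perm Omega}}).
Hypothesis Om3 : (2 < #|Omega|)%N.
Hypothesis sFF' : F \subset F'.
Hypothesis Fft : freely_transitive F.
Implicit Types (v w x y u : T) (a b d : Omega) (f s : {perm Omega}).
Implicit Types (xi eta : tree_end T).
Local Notation nb := (neighbour c).
Local Notation word := (word c).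
Local Notation walk := (walk c).
Local Notation branch := (branch c).
Local Notation lp := (local_perm c).
Local Notation G := (GFF_star_type c F F').
Local Notation rist := (@rist _ _ c F F').
Local Notation is_elem := (@is_elem _ _ c F F').
Local Notation edir := (edir c).
Local Notation eray := (eray c).
Local Notation eword := (eword c).
Local Notation tail := (tail c).
Local Notation near_end := (near_end c).
Implicit Types (g h : G).

Lemma tail_avoid xi v (A : set T) : finite_set A ->
  exists N, forall n x, (N <= n)%N -> A x -> ~ tail xi v n x.
Proof.
move=> /finite_seqP [l ->]; elim: l => [|y l [N NP]]; first by exists 0%N.
have [M MP] := tail_sub c xi v y.
exists (maxn N M) => n x; rewrite geq_max => /andP [Nn Mn].
rewrite /= inE => /orP [/eqP ->|/(NP n x Nn)//].
by move/(MP n Mn)/branch_irr.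
Qed.

(** An elliptic element that fixes an end fixes a ray to it pointwise. Only
    finitely many of its local permutations lie outside [F], so some
    half-tree around the end has none of them, and rigidity shows that it is
    fixed. *)
Lemma ell_branch xi g : elliptic_stab c F F' xi g <->
  exists u, forall x, branch u (edir u xi) x -> g x = x.
Proof.
have [_ gF gt] := GP g.
split=> [[ge gxi]|[u ub]].
  have [u gu] := elliptic_fix c gt ge.
  have fixr n : g (eray xi u n) = eray xi u n.
    have gxi' : end_act (GFF_val g) xi = xi := gxi.
    by rewrite -eray_act gu gxi'.
  have [N NP] := tail_avoid xi u gF.
  exists (eray xi u N); rewrite edir_eray.
  apply: (fixes_branch Fft) => //; first by rewrite -erayS.
  by move=> x tx; apply: contraT => xF; case: (NP N x (leqnn N) xF).
have [v] := tree_inhabited T.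
have [N /(_ N (leqnn N)) sub] := tail_sub c xi v u.
have fixw k : g (eray xi v (N.+1 + k)) = eray xi v (N.+1 + k).
  apply/ub/sub/(@tail_decr _ _ c xi v N (N + k) (leq_addr _ _)).
  by rewrite addSn; exact: eray_tail.
split; first by left; exists (eray xi v N.+1); have := fixw 0%N; rewrite addn0.
pose w := eray xi v N.+1.
have gw : g w = w by have := fixw 0%N; rewrite addn0.
have rE k : eray xi w k = eray xi v (N.+1 + k).
  elim: k => [|k IH]; first by rewrite addn0.
  by rewrite erayS IH eword_eray -erayS addnS.
apply: (@end_eq _ _ _ (eray xi w)); last exact: end_eray.
suff {1}-> : eray xi w = eray (end_act g xi) w by exact: end_eray.
by apply/funext => k; rewrite -{2}gw eray_act rE fixw.
Qed.

Lemma ell_tail xi v g : elliptic_stab c F F' xi g <->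
  exists N, forall n x, (N <= n)%N -> tail xi v n x -> g x = x.
Proof.
rewrite ell_branch; split=> [[u ub]|[N NP]].
  have [N NP] := tail_sub c xi v u.
  by exists N => n x /NP sb /sb; exact: ub.
exists (eray xi v N) => x; rewrite edir_eray; exact: NP.
Qed.

Lemma ell_subgroup xi : is_subgroup (elliptic_stab c F F' xi).
Proof.
have [v] := tree_inhabited T; split.
- by apply/(ell_tail xi v); exists 0%N.
- move=> g h /(ell_tail xi v) [m mP] /(ell_tail xi v) [n nP].
  apply/(ell_tail xi v); exists (maxn m n) => k x; rewrite geq_max => /andP [mk nk] tx.
  by rewrite GmulE (nP k) // (mP k).
- move=> g /(ell_tail xi v) [m mP]; apply/(ell_tail xi v); exists m => k x mk tx.
  by rewrite -{1}(mP k x mk tx) GinvK.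
Qed.

(** The elliptic stabiliser as a point of the space of subgroups. *)
Definition ell xi : sub_space G := SubSpace (ell_subgroup xi).

Lemma stab_sep xi g : boundary_action c F F' g xi <> xi ->
  near_end xi [set eta | boundary_action c F F' g eta <> eta].
Proof.
move=> /(near_sep c) [u h].
have n1 : near_end xi [set eta | edir u eta = edir u xi] by exists u.
have n2 : near_end xi [set eta | edir (g^-1 u) eta = edir (g^-1 u) xi] by exists (g^-1 u).
have [w wP] := nearI n1 n2; exists w => eta /wP [/= e1 e2] E; apply: h.
rewrite -e1 -[X in _ = edir u X]E -(GKinv g u).
by rewrite [LHS](edir_act c g) [RHS](edir_act c g) e2.
Qed.

(** Membership in the elliptic stabiliser is locally constant in the end: a
    half-tree fixed by [g] serves for all the ends in it, while an end moved
    by [g] has a neighbourhood of such ends, and an element that is not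
    elliptic never belongs. *)
Lemma ell_near1 xi g : near_end xi [set eta | sub_set (ell eta) g <-> sub_set (ell xi) g].
Proof.
have [eg|neg] := pselect (elliptic_stab c F F' xi g).
  have /ell_branch [u uP] := eg.
  exists u => eta E; split=> // _; apply/ell_branch; exists u; rewrite E; exact: uP.
have [gxi|gxi] := pselect (boundary_action c F F' g xi = xi).
  have [v] := tree_inhabited T; exists v => eta _; split=> // -[ge _].
  by case: neg; split.
have [u uP] := stab_sep gxi; exists u => eta /uP h; split=> // -[_ /h] [].
Qed.

Lemma near_agree xi (f : tree_end T -> sub_space G) D :
  (forall g, near_end xi [set eta | sub_set (f eta) g <-> sub_set (f xi) g]) ->
  near_end xi [set eta | agree D (f xi) (f eta)].
Proof.
move=> fn; elim: D => [|g D [w wP]]; first by have [v] := tree_inhabited T; exists v.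
have [u uP] := nearI (fn g) (ex_intro _ w wP).
by exists u => eta /uP [h1 h2] h; rewrite inE => /orP [/eqP ->|/h2].
Qed.

Lemma ell_near xi D : near_end xi [set eta | agree D (ell xi) (ell eta)].
Proof. by apply: near_agree => g; exact: ell_near1. Qed.

Lemma ell_conj g xi : conj_sub g (ell xi) = ell (boundary_action c F F' g xi).
Proof.
have sub h eta : sub_set (ell eta) h ->
    forall k, sub_set (ell (boundary_action c F F' k eta)) (k * h * k^-1).
  move=> /ell_branch [u uP] k; apply/ell_branch; exists (k u) => x bx.
  rewrite !GmulE uP ?GKinv //.
  apply/(branch_aut c k); rewrite -[X in branch _ _ X]/((k : G) (k^-1 x)) GKinv.
  by move: bx; rewrite [edir _ _](edir_act c k).
apply: sub_space_ext; apply/seteqP; split=> [_ [h hx <-]|h hx]; first exact: sub.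
exists (g^-1 * h * g); last by rewrite !mulgA mulgV mul1g mulgK.
have := sub _ _ hx g^-1; rewrite invgK -hactM mulVg hact1 //.
Qed.

(** The elements fixing [v] with all local permutations equal to some [f] in
    [F] suffice, as [F] is transitive. *)
Lemma edir_transitive xi v a : exists g : G, edir v (boundary_action c F F' g xi) = a.
Proof.
have [f fF fa] := trans_pt Fft.1 (edir v xi) a.
have vv : ~~ odd_dist c v v by rewrite /odd_dist wordxx.
have [g [gv gl]] := trans_G sFF' fF vv.
by exists g; rewrite -{1}gv [LHS](edir_act c g) gl.
Qed.

(** Orbits of ends are dense, and the elliptic stabiliser depends
    continuously on the end. *)
Lemma orbit_closure V xi eta : closed V -> conj_invariant V -> V (ell xi) -> V (ell eta).
Proof.
move=> cV iV Vxi; apply: ((sub_closedP V).1 cV) => D.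
have [u uP] := ell_near eta D.
have [g gu] := edir_transitive xi u (edir u eta).
exists (ell (boundary_action c F F' g xi)); last exact: uP.
by rewrite -ell_conj; exact: iV.
Qed.

(** Ends fixed by no hyperbolic element. *)
Definition generic xi := forall g, boundary_action c F F' g xi = xi -> elliptic (GFF_val g).

Lemma generic_stab xi : generic xi -> stab (boundary_action c F F') xi = ell xi.
Proof.
move=> gx; apply: sub_space_ext; apply/seteqP; split=> g /=; last by case.
by move=> h; split=> //; exact: gx.
Qed.

Lemma generic_act xi g : generic xi -> generic (boundary_action c F F' g xi).
Proof.
move=> gx h hg; have : boundary_action c F F' (g^-1 * h * g) xi = xi.
  by rewrite !hactM hg -hactM mulVg hact1.
move/gx => he; have [_ _ t] := GP (g^-1 * h * g).
have [v gv] := elliptic_fix c t he; left; exists (g v).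
by rewrite -[in RHS]gv -[RHS]/((g * (g^-1 * h * g)) v) !mulgA mulgV mul1g.
Qed.

(** A hyperbolic element fixing an end translates a ray towards it. Far
    along the ray its local permutations lie in [F], and consecutive ones
    agree at a colour, so they are constant; hence the colours of the ray
    are eventually periodic. *)
Lemma hyperbolic_periodic xi v g : boundary_action c F F' g xi = xi ->
  ~ elliptic (GFF_val g) -> exists L N, (0 < L)%N /\
  forall n, (N <= n)%N -> eword xi v (n + L) = eword xi v n.
Proof.
move=> gxi ng; have [_ gF _] := GP g.
have [k [l kl]] := eray_cofinal c xi (g v) v.
have act n : eray xi (g v) n = g (eray xi v n) /\
    eword xi (g v) n = lp g (eray xi v n) (eword xi v n).
  by rewrite -{1 3}gxi -eray_act -eword_act.
have [N0 N0P] := tail_avoid xi v gF.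
have inF n : (N0 < n)%N -> lp g (eray xi v n) \in F.
  case: n => // n /ltnSE Nn; apply: contraT => xF.
  by case: (N0P n _ Nn xF); exact: eray_tail.
pose a := eword xi v; pose f := lp g (eray xi v N0.+1).
(* Neighbouring local permutations agree at the colour of the common edge. *)
have const n : lp g (eray xi v (N0.+1 + n)) = f.
  elim: n => [|n IH]; first by rewrite addn0.
  rewrite -IH; apply: (free_eq Fft (a := a (N0.+1 + n)%N));
    rewrite ?inF // ?addnS ?addSn ?ltnS ?leq_addr //.
    by rewrite leqW // leq_addr.
  by rewrite erayS local_perm_edge.
have trans n : (N0 < n)%N -> a (l + n)%N = f (a (k + n)%N).
  move=> n0; rewrite /a -(kl n).2 (act _).2.
  have -> : (k + n = N0.+1 + (k + n - N0.+1))%N by rewrite subnKC // ltn_addl.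
  by rewrite const.
have [f' [d [d0 [M ad]]]] : exists f' (d : nat), (0 < d)%N /\ exists M, forall m, (M <= m)%N ->
    a (m + d)%N = (f' : {perm Omega}) (a m).
  case: (ltngtP k l) => [kl'|lk|E].
  - exists f, (l - k)%N; rewrite subn_gt0; split=> //; exists (k + N0).+1 => m mM.
    have km : (k <= m)%N := ltnW (leq_ltn_trans (leq_addr N0 k) mM).
    have := trans (m - k)%N; rewrite subnKC // ltn_subRL => /(_ mM) <-.
    by congr a; rewrite addnBA ?(ltnW kl') // addnC addnBA.
  - exists f^-1, (k - l)%N; rewrite subn_gt0; split=> //; exists (l + N0).+1 => m mM.
    have km : (l <= m)%N := ltnW (leq_ltn_trans (leq_addr N0 l) mM).
    have := trans (m - l)%N; rewrite subnKC // ltn_subRL => /(_ mM) ->.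
    rewrite permK; congr a; by rewrite addnBA ?(ltnW lk) // addnC addnBA.
  case: ng; left; exists (eray xi v k).
  by have [+ _] := kl 0%N; rewrite !addn0 (act k).1 -E.
have iterd j m : (M <= m)%N -> a (m + j * d)%N = (f' ^+ j) (a m).
  elim: j m => [|j IH] m Mm; first by rewrite mul0n addn0 expg0 perm1.
  by rewrite mulSn addnA IH ?ad ?expgS ?permM // (leq_trans Mm) // leq_addr.
exists (#[f'] * d)%N, M; split; first by rewrite muln_gt0 order_gt0.
by move=> n Mn; rewrite -/a iterd // expg_order perm1.
Qed.

Lemma generic_exists : exists xi, generic xi.
Proof.
have [x [y [z [xy xz yz]]]] : exists x y z : Omega, [/\ x != y, x != z & y != z].
  have : uniq (enum Omega) by exact: enum_uniq.
  have : (2 < size (enum Omega))%N by rewrite -cardE.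
  case: (enum Omega) => [|x [|y [|z l]]] //= _.
  by rewrite !inE !negb_or => /andP [/and3P [xy xz _]] /andP [/andP [yz _]] _; exists x, y, z.
have [v] := tree_inhabited T.
have ip : ireduced (square_seq x y z).
  move=> n; rewrite /square_seq /=; case: (odd n) => /=; first by case: ifP; rewrite eq_sym.
  by case: ifP.
have [xi xiE] := end_of_word c v ip.
exists xi => g gxi; apply: contrapT => ng.
have [L [N [L0 LP]]] := hyperbolic_periodic v gxi ng.
have yz' : y <> z by apply/eqP.
have [n Nn] := square_seq_aperiodic x yz' N L0; apply.
by rewrite -xiE -addnn addnA !LP // (leq_trans Nn) // leq_addr.
Qed.

Lemma generic_dense u a : exists2 xi, generic xi & edir u xi = a.
Proof.
have [xi gx] := generic_exists; have [g ga] := edir_transitive xi u a.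
by exists (boundary_action c F F' g xi) => //; exact: generic_act.
Qed.

Lemma stab_cont xi : {for xi, continuous (stab (boundary_action c F F'))} <->
  forall g, near_end xi [set eta | sub_set (stab (boundary_action c F F') eta) g <->
    sub_set (stab (boundary_action c F F') xi) g].
Proof.
split=> [cont g|h A /sub_nbhsP [D DA]].
  by apply/nbhs_near; exact: (cont _ (nbhs_mem _ g)).
apply/nbhs_near; have [u uP] := near_agree D h.
by exists u => eta /uP; exact: DA.
Qed.

Lemma generic_cont xi : generic xi -> {for xi, continuous (stab (boundary_action c F F'))}.
Proof.
move=> gx; apply/stab_cont => g.
have [gxi|gxi] := pselect (boundary_action c F F' g xi = xi).
  have [u uP] := ell_near1 xi g; exists u => eta /uP [_ h]; split=> // _.
  by have [] := h (conj (gx g gxi) gxi).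
by have [u uP] := stab_sep gxi; exists u => eta /uP h; split=> // /h [].
Qed.

(** Both stabilisers are continuous at such an end and agree at the generic
    ends, which are dense. *)
Lemma cont_ell xi : {for xi, continuous (stab (boundary_action c F F'))} ->
  stab (boundary_action c F F') xi = ell xi.
Proof.
move=> /stab_cont cont; apply: sub_space_ext; apply/seteqP.
suff H g : sub_set (stab (boundary_action c F F') xi) g <-> sub_set (ell xi) g.
  by split=> g /H.
have [u uP] := nearI (cont g) (ell_near1 xi g).
have [eta ge /uP [/= h1 h2]] := generic_dense u (edir u xi).
rewrite -h1 -h2 -[X in X <-> _]/(sub_set (stab (boundary_action c F F') eta) g).
by rewrite (generic_stab ge).
Qed.

(** The image of the compact space of ends under a continuous map. *)
Lemma ell_closed : closed [set H | exists xi, H = ell xi].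
Proof.
apply/sub_closedP => H cH.
pose F0 : set_system (tree_end T) :=
  filter_from setT (fun D => [set xi | agree D H (ell xi)]).
have FF : ProperFilter F0.
  apply: filter_from_proper; last first.
    by move=> D _; have [_ [xi ->] h] := cH D; exists xi.
  apply: filter_from_filter; first by exists [::].
  move=> D D' _ _; exists (D ++ D') => // xi h.
  by split=> g gD; apply: h; rewrite mem_cat gD ?orbT.
have [V [VU sV]] := @ultraFilterLemma _ F0 _.
have [xi xiP] := ends_ultra c VU; exists xi.
apply: sub_space_ext; apply/seteqP.
suff Hg g : sub_set H g <-> sub_set (ell xi) g by split=> g /Hg.
have V1 : V [set eta | agree [:: g] H (ell eta)] by apply: sV; exists [:: g].
have V2 := xiP _ (ell_near1 xi g).
have [eta [h1 h2]] := filter_ex (filterI V1 V2).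
have e := h1 g (mem_head g [::]).
by split=> [/(e.2)/(h2.1)|/(h2.2)/(e.1)].
Qed.

Lemma stabilizer_URSE :
  stabilizer_URS (boundary_action c F F') = [set H | exists xi, H = ell xi].
Proof.
apply/seteqP; split=> [H|H [xi ->]].
  move=> cH; rewrite ((closure_id _).1 ell_closed); move: H cH.
  by apply: closureS => _ [xi /= /cont_ell -> <-]; exists xi.
apply/sub_closureP => D; have [u uP] := ell_near xi D.
have [eta ge E] := generic_dense u (edir u xi).
exists (ell eta); last exact: uP.
by exists eta; [exact: generic_cont|exact: generic_stab].
Qed.

Lemma stabilizer_URS_URS : is_URS (stabilizer_URS (boundary_action c F F')).
Proof.
rewrite stabilizer_URSE; split.
- by have [xi _] := generic_exists; exists (ell xi), xi.
- exact: ell_closed.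
- by move=> g _ [xi ->]; rewrite ell_conj; eexists.
move=> V [H VH] cV iV sV; apply/seteqP; split=> // _ [eta ->].
by have [xi E] := sV _ VH; rewrite E in VH; exact: orbit_closure VH.
Qed.

End Stabilisers.

(** * Amenability *)

Section Amenability.
Import Order.TTheory GRing.Theory Num.Theory numFieldNormedType.Exports.
Local Open Scope group_scope.
Variables (R : realType) (G : groupType).
Implicit Types (H A B : set G) (D : seq G).

Lemma gen_sub A : is_subgroup (gen_subgroup A).
Proof.
split=> [K [[K1 _ _] _] //|x y xA yA K KA|x xA K KA].
  by have [[_ KM _] _] := KA; apply: KM; [exact: xA|exact: yA].
by have [[_ _ KV] _] := KA; apply: KV; exact: xA.
Qed.

Lemma sub_gen A : A `<=` gen_subgroup A.
Proof. by move=> x Ax K [_]; exact. Qed.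

Lemma gen_min A H : is_subgroup H -> A `<=` H -> gen_subgroup A `<=` H.
Proof. by move=> Hs AH x; apply; split. Qed.

Definition mean (E A : set G) : R := ((#|` fset_set (A `&` E)|)%:R / (#|` fset_set E|)%:R)%R.

Lemma ultra_fmap (I J : Type) (V : set_system I) (f : I -> J) :
  UltraFilter V -> UltraFilter (f @ V).
Proof.
move=> VU; split=> [|W PW VW]; first exact: fmap_proper_filter.
apply/seteqP; split=> // A WA; have [//|nA] := in_ultra_setVsetC (f @^-1` A) VU.
have WC : W (~` A) by apply: VW.
by have [x []] := filter_ex (filterI WA WC).
Qed.

Lemma mean_ge0 E A : (0 <= mean E A)%R.
Proof. by rewrite /mean divr_ge0 // ler0n. Qed.

Lemma mean_le1 E A : finite_set E -> (mean E A <= 1)%R.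
Proof.
move=> fE; rewrite /mean; have [->|E0] := eqVneq (#|` fset_set E|) 0%N.
  by rewrite invr0 mulr0 ler01.
rewrite ler_pdivrMr ?ltr0n ?lt0n // mul1r ler_nat fsubset_leq_card //.
have fAE : finite_set (A `&` E) by apply: sub_finite_set fE; exact: subIsetr.
by rewrite -fset_set_sub //; exact: subIsetr.
Qed.

(** The mean is a limit of the uniform measures on the finite subgroups
    generated by finite subsets, along an ultrafilter for which these
    subsets eventually contain any given element. *)
Lemma locally_finite_amenable H : is_subgroup H -> locally_finite H -> amenable R H.
Proof.
move=> Hs Hlf.
pose E D := gen_subgroup [set` D].
have fE D : [set` D] `<=` H -> finite_set (E D).
  by move=> DH; apply: Hlf => //; apply/finite_seqP; exists D.
pose V0 : set_system (seq G) := filter_from [set D | [set` D] `<=` H]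
  (fun D => [set D' | [set` D'] `<=` H /\ [set` D] `<=` [set` D']]).
have FV : ProperFilter V0.
  apply: filter_from_proper; last by move=> D DH; exists D; split.
  apply: filter_from_filter; first by exists [::] => x.
  move=> D D' DH D'H; exists (D ++ D').
    by move=> x /=; rewrite mem_cat => /orP [/DH|/D'H].
  by move=> D'' [D''H s]; split; split=> // x xD; apply: s; rewrite /= mem_cat xD ?orbT.
have [V [VU sV]] := @ultraFilterLemma _ V0 _.
have VH D0 : [set` D0] `<=` H -> V [set D | [set` D] `<=` H /\ [set` D0] `<=` [set` D]].
  by move=> D0H; apply: sV; exists D0.
have lim A : exists p : R, (0 <= p)%R /\ (fun D => mean (E D) A) @ V --> p.
  have UI : UltraFilter ((fun D => mean (E D) A) @ V) by exact: ultra_fmap.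
  have := @segment_compact R 0%R 1%R; rewrite compact_ultra => /(_ _ UI) [].
    have : [set` [::] : seq G] `<=` H by move=> x.
    move=> /VH /=; apply: filterS => D [DH _] /=.
    by rewrite in_itv /= mean_ge0 mean_le1 //; exact: fE.
  by move=> p [/=]; rewrite in_itv /= => /andP [p0 _] h; exists p.
pose mu A := projT1 (cid (lim A)).
have mu0 A : (0 <= mu A)%R by rewrite /mu; case: cid => p [].
have mucv A : (fun D => mean (E D) A) @ V --> mu A by rewrite /mu; case: cid => p [].
have uniq D0 (f h : seq G -> R) (p q : R) : [set` D0] `<=` H ->
    (forall D, [set` D] `<=` H -> [set` D0] `<=` [set` D] -> f D = h D) ->
    f @ V --> p -> h @ V --> q -> p = q.
  move=> D0H fh fp hq; apply: (@cvg_unique _ (@Rhausdorff R) (f @ V)) => //.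
  apply: cvg_trans hq; apply: near_eq_cvg; apply: filterS (VH _ D0H) => D [DH D0D].
  by rewrite /= fh.
have nil : [set` [::] : seq G] `<=` H by move=> x.
have E1 D : E D 1 by have [] := gen_sub [set` D].
have cardE D : [set` D] `<=` H -> (#|` fset_set (E D)|%:R != 0 :> R)%R.
  move=> DH; rewrite pnatr_eq0 -lt0n cardfs_gt0; apply/fset0Pn; exists 1.
  by rewrite in_fset_set ?inE; [exact: E1|exact: fE].
exists mu; split=> //.
- apply: (uniq [::] (fun D => mean (E D) H) (fun=> 1%R)) => //; last exact: cvg_cst.
  move=> D DH _; rewrite /mean (_ : H `&` E D = E D) ?divff ?cardE //.
  by apply/seteqP; split=> [x []//|x Ex]; split=> //; exact: (gen_min Hs DH).
- move=> A B AH BH AB.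
  apply: (uniq [::] (fun D => mean (E D) (A `|` B))
     (fun D => (mean (E D) A + mean (E D) B)%R)) => //; last exact: cvgD.
  move=> D DH _; rewrite /mean -mulrDl -natrD; congr (_%:R / _)%R.
  have fI C : finite_set (C `&` E D) by apply: sub_finite_set (fE _ DH); exact: subIsetr.
  rewrite setIUl fset_setU // cardfsU -fset_setI // setIACA AB set0I fset_set0.
  by rewrite cardfs0 subn0.
move=> h A Hh AH.
apply: (uniq [:: h] (fun D => mean (E D) [set h * a | a in A]) (fun D => mean (E D) A)) => //.
  by move=> x /=; rewrite inE => /eqP ->.
move=> D DH hD; rewrite /mean; congr (_%:R / _)%R.
have [_ EM EV] := gen_sub [set` D].
have Eh : E D h by apply: sub_gen; apply: hD; rewrite /= inE.
have fI C : finite_set (C `&` E D) by apply: sub_finite_set (fE _ DH); exact: subIsetr.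
have -> : [set h * a | a in A] `&` E D = (fun a => h * a) @` (A `&` E D).
  apply/seteqP; split=> x.
    move=> [[a Aa <-] Ea]; exists a => //; split=> //.
    by rewrite -(mulKg h a); apply: EM => //; exact: EV.
  by move=> [a [Aa Ea] <-]; split; [exists a|exact: EM].
by rewrite fset_set_image // card_imfset //; exact: mulgI.
Qed.
End Amenability.

Section EllipticStabilisers.
Import Order.TTheory GRing.Theory Num.Theory.
Local Open Scope group_scope.
Variables (Omega : finType) (T : tree) (c : legal_colouring Omega T).
Variables (F F' : {group {perm Omega}}).
Hypothesis Om3 : (2 < #|Omega|)%N.
Hypothesis sFF' : F \subset F'.
Hypothesis Fft : freely_transitive F.
Hypothesis F'2 : two_transitive F'.
Implicit Types (v w x y u : T) (a b d : Omega) (f : {perm Omega}).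
Implicit Types (xi eta : tree_end T).
Local Notation nb := (neighbour c).
Local Notation word := (word c).
Local Notation walk := (walk c).
Local Notation branch := (branch c).
Local Notation lp := (local_perm c).
Local Notation G := (GFF_star_type c F F').
Local Notation is_elem := (@is_elem _ _ c F F').
Local Notation edir := (edir c).
Local Notation eray := (eray c).
Local Notation eword := (eword c).
Local Notation tail := (tail c).
Implicit Types (g h : G).

(** Along the ray to the end there are elements of the elliptic stabiliser
    whose only local permutation outside [F] occurs at a prescribed vertex
    of the ray. *)
Lemma ell_infinite xi : infinite_set (elliptic_stab c F F' xi).
Proof.
have [v] := tree_inhabited T.
pose a := eword xi v.
have sE n : exists s : {perm Omega}, [/\ s \in F', s (a n) = a n & s <> 1].
  have [b ba] := other_colour Om3 (a n); have [d da db] := third_colour Om3 (a n) b.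
  have [s [sF' sa sb]] := two_trans_stab F'2 ba da.
  exists s; split=> // s1; move: db; rewrite -sb s1 perm1 eqxx //.
have gE n : exists g, exists s : {perm Omega},
    [/\ s (a n) = a n, s <> 1 & is_elem (eray xi v n) s g].
  have [s [sF' sa s1]] := sE n.
  by have [g ge] := elem_exists c sFF' Fft (eray xi v n) sF'; exists g, s.
pose gn n := projT1 (cid (gE n)).
have gnP n : exists s : {perm Omega}, [/\ s (a n) = a n, s <> 1 & is_elem (eray xi v n) s (gn n)].
  by rewrite /gn; case: cid.
have ginj : injective gn.
  move=> m n E; apply: (is_ray_iwalk c v (eword_reduced c xi v)).1.
  apply: contrapT => h.
  have [s [sa s1 [_ sl _]]] := gnP m; have [s' [_ _ [_ _ slF]]] := gnP n.
  apply: s1; apply: (free_eq Fft (a := a m)); rewrite ?group1 ?perm1 // -sl E.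
  exact: slF.
have ell_gn n : elliptic_stab c F F' xi (gn n).
  have [s [sa _ ge]] := gnP n; apply/(ell_branch Fft); exists (eray xi v n).
  by rewrite edir_eray => x; exact: elem_fixes_branch ge sa.
move=> fin; apply: infinite_nat.
have -> : [set: nat] = gn @^-1` elliptic_stab c F F' xi.
  by apply/seteqP; split=> n // _; exact: ell_gn.
by apply: finite_preimage fin => m n _ _; exact: ginj.
Qed.

Definition ball_group u n : set G :=
  [set g : G | g u = u /\ forall x, (n < size (word u x))%N -> lp g x \in F].

Lemma ball_subgroup u n : is_subgroup (ball_group u n).
Proof.
have sz (g : G) x : g u = u -> size (word u (g x)) = size (word u x).
  by move=> gu; rewrite -{1}gu word_aut size_lword.
split=> [|g h [gu gF] [hu hF]|g [gu gF]].
- by split=> // x _; rewrite local_perm1 group1.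
- split=> [|x nx]; first by rewrite GmulE hu.
  by rewrite local_permM groupM //; [exact: hF|apply: gF; rewrite sz].
- have gu' : g^-1 u = u by rewrite -{1}gu GinvK.
  split=> // x nx; rewrite local_permV groupV; apply: gF.
  by rewrite (_ : size _ = size (word u x)) //; exact: (sz g^-1 x gu').
Qed.

(** The local permutations in the ball determine the element: outside of it
    they lie in [F] and are determined by their value at the colour of the
    edge leading back. *)
Lemma ball_finite u n : finite_set (ball_group u n).
Proof.
pose th g : {ffun {bseq n of Omega} -> {perm Omega}} :=
  [ffun s : {bseq n of Omega} => lp g (walk u s)].
suff th_inj : {in ball_group u n &, injective th}.
  by rewrite -(eq_finite_set (inj_card_eq th_inj)); exact: finite_finset.
move=> g h /set_mem [gu gF] /set_mem [hu hF] E.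
have Es s : (size s <= n)%N -> lp g (walk u s) = lp h (walk u s).
  by move=> sn; have := congr1 (fun t : {ffun _ -> _} => t (Bseq sn)) E; rewrite !ffunE.
suff H s : reduced s -> g (walk u s) = h (walk u s) /\ lp g (walk u s) = lp h (walk u s).
  by apply: G_ext => x; rewrite -(walk_word c u x) (H _ (word_reduced c u x)).1.
elim/last_ind: s => [_|s a IH rs].
  by rewrite /= gu hu; split=> //; exact: (Es [::]).
have rs' : reduced s.
  have : take (size s) (rcons s a) = s by rewrite -cats1 take_size_cat.
  by move=> <-; exact: take_sorted.
have [E1 E2] := IH rs'; rewrite !walk_rcons; split; first by rewrite !aut_neighbour E1 E2.
have [sn|ns] := leqP (size (rcons s a)) n; first by rewrite -!walk_rcons Es.
apply: (free_eq Fft (a := a)); last by rewrite !local_perm_edge E2.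
  by apply: gF; rewrite -walk_rcons word_walk_reduced.
by apply: hF; rewrite -walk_rcons word_walk_reduced.
Qed.

Lemma ell_locally_finite xi : locally_finite (elliptic_stab c F F' xi).
Proof.
move=> A sA /finite_seqP [l lE].
have [v] := tree_inhabited T.
have [N NP] : exists N, forall n g, (N <= n)%N -> g \in l ->
    g (eray xi v n.+1) = eray xi v n.+1.
  have : forall g, g \in l -> exists N, forall n x, (N <= n)%N -> tail xi v n x -> g x = x.
    by move=> g gl; apply/(ell_tail Fft xi v)/sA; rewrite lE.
  elim: l {lE} => [|g l IH] H; first by exists 0%N.
  have [|N NP] := IH; first by move=> h hl; apply: H; rewrite inE hl orbT.
  have [|M MP] := H g; first by rewrite inE eqxx.
  exists (maxn N M) => n h; rewrite geq_max inE.
  move=> /andP [Nn Mn] /orP [/eqP ->|/(NP n)]; last exact.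
  exact: MP Mn (eray_tail _ _ _ _).
pose u := eray xi v N.+1.
have [M MP] : exists M, forall g x, g \in l -> lp g x \notin F -> (size (word u x) <= M)%N.
  elim: l {lE NP} => [|g l [M IH]]; first by exists 0%N.
  have [m mP] := sing_bound g u; exists (maxn M m) => h x.
  by rewrite inE leq_max => /orP [/eqP ->|/IH h'] /=; [move=> /mP ->; rewrite orbT|move=> /h' ->].
apply: (sub_finite_set _ (ball_finite u M)); apply: gen_min; first exact: ball_subgroup.
rewrite lE => g gl; split=> [|x Mx]; first exact: NP.
by apply: contraT => /(MP g x gl); rewrite leqNgt Mx.
Qed.

Lemma ell_amenable (R : realType) xi : amenable R (elliptic_stab c F F' xi).
Proof.
by apply: locally_finite_amenable; [exact: ell_subgroup|exact: ell_locally_finite].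
Qed.

(** [F] permutes the half-trees at a vertex transitively, so an invariant
    mean gives them all the same mass, at most one third; but the two sides
    of an edge cover the tree. *)
Lemma G_not_amenable (R : realType) : ~ amenable R [set: G].
Proof.
move=> [mu [mu1 mu0 muD muI]]; have [v] := tree_inhabited T.
pose m x a : R := mu [set g : G | branch x a (g v)].
have mE x a b : m x a = m x b.
  have [f fF fa] := trans_pt Fft.1 a b.
  have xx : ~~ odd_dist c x x by rewrite /odd_dist wordxx.
  have [h [hx hl]] := trans_G sFF' fF xx.
  rewrite /m -(muI h [set g : G | branch x a (g v)]) //; congr mu.
  apply/seteqP; split=> [_ [g ga <-]|g gb].
    by have := (branch_aut c h x a (g v)).2 ga; rewrite hx hl fa.
  exists (h^-1 * g); last by rewrite mulKVg.
  by apply/(branch_aut c h x a (h^-1 (g v))); rewrite GKinv hx hl fa.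
have muD' A B : A `&` B = set0 -> mu (A `|` B) = (mu A + mu B)%R by move=> AB; apply: muD.
have mu0' A : (0 <= mu A)%R by apply: mu0.
(* Three of the half-trees at a vertex are disjoint and have the same mass. *)
have third x a : (m x a + m x a + m x a <= 1)%R.
  have [b ba] := other_colour Om3 a; have [d da db] := third_colour Om3 a b.
  rewrite {2}(mE x a b) {2}(mE x a d).
  have dis e e' : e <> e' ->
      [set g : G | branch x e (g v)] `&` [set g : G | branch x e' (g v)] = set0.
    by move=> ee; apply/seteqP; split=> // g [h1 h2]; case: ee; exact: branch_disj h1 h2.
  rewrite -muD'; last by apply: dis => E; rewrite E eqxx in ba.
  rewrite -muD'; last first.
    by rewrite setIUl !dis ?setU0 // => E; [rewrite E eqxx in db|rewrite E eqxx in da].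
  set B := (X in (mu X <= _)%R); rewrite -mu1 -(setUv B) muD' ?setICr // lerDl; exact: mu0'.
have [a _] : exists a : Omega, True.
  have : (0 < #|Omega|)%N by apply: leq_trans Om3.
  by case/card_gt0P => a _; exists a.
have : (m v a + m (nb v a) a = 1)%R.
  rewrite -mu1 -muD'; last by apply/seteqP; split=> // g [h1 /branchC h2].
  congr mu; apply/seteqP; split=> // g _.
  by have [|/branchC] := pselect (branch v a (g v)); [left|right].
have := third v a; have := third (nb v a) a; lra.
Qed.

End EllipticStabilisers.

(** * Subgroups that move an end, and half-trees in general position *)

Section Combinatorics.
Local Open Scope group_scope.
Import GRing.Theory.

(** Otherwise each of the lines on which only the coordinates other than [i]
    are translated contains at most one point of colour [i]; there are too
    few such lines, because the side of the cube exceeds the number of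
    coordinates. *)
Lemma diagonal_colouring n (chi : {ffun 'I_n.+2 -> 'I_n.+3} -> 'I_n.+2) :
  exists m m', chi m = chi m' /\ forall j, (m j == m' j) = (j == chi m).
Proof.
apply: contrapT => no.
pose d (i : 'I_n.+2) : 'I_n.+2 := if i == ord0 then ord_max else ord0.
have dP i : d i != i by by rewrite /d; case: (eqVneq i ord0) => [->|i0] //; rewrite eq_sym.
(* The colour of [x], the line of that colour through [x], normalised at the
   coordinate [d], and a free parameter stored at this coordinate. *)
pose psi (xt : {ffun 'I_n.+2 -> 'I_n.+3} * 'I_n.+3) :=
  let: (x, t) := xt in
  (chi x, [ffun j => if j == chi x then x j else
     if j == d (chi x) then t else (x j - x (d (chi x)))%R]).
have psi_inj : injective psi.
  move=> [x t] [x' t'] [E /ffunP fE].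
  have ec : x (chi x) = x' (chi x) by have := fE (chi x); rewrite !ffunE -E eqxx.
  have et : t = t' by have := fE (d (chi x)); rewrite !ffunE -E (negbTE (dP _)) eqxx.
  have ej j : j != chi x -> (x j - x (d (chi x)) = x' j - x' (d (chi x)))%R.
    move=> jc; have [->|jd] := eqVneq j (d (chi x)); first by rewrite !subrr.
    by have := fE j; rewrite !ffunE -E (negbTE jc) (negbTE jd).
  rewrite et; congr pair; have [ed|ed] := eqVneq (x (d (chi x))) (x' (d (chi x))).
    apply/ffunP => j; have [->//|jc] := eqVneq j (chi x).
    by have := ej j jc; rewrite ed => /addIr.
  case: no; exists x, x'; split=> // j; have [->|jc] := eqVneq j (chi x).
    by rewrite ec eqxx.
  apply/negP => /eqP xj; have := ej j jc; rewrite xj => /addrI /oppr_inj /eqP.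
  by rewrite (negbTE ed).
have := leq_card psi psi_inj; rewrite !card_prod !card_ffun !card_ord mulnC.
by rewrite leq_pmul2r ?ltnn // expn_gt0.
Qed.

Lemma eventually_all (J : finType) (P : J -> nat -> Prop) :
  (forall j, exists N, forall n, (N <= n)%N -> P j n) ->
  exists N, forall j, P j N.
Proof.
move=> h; pose N j := projT1 (cid (h j)).
have NP j n : (N j <= n)%N -> P j n by rewrite /N; case: cid => M; apply.
by exists (\max_j N j) => j; apply: NP; exact: leq_bigmax.
Qed.
End Combinatorics.

Section Main.
Local Open Scope group_scope.
Variables (Omega : finType) (T : tree) (c : legal_colouring Omega T).
Variables (F F' : {group {perm Omega}}).
Hypothesis Om3 : (2 < #|Omega|)%N.
Hypothesis sFF' : F \subset F'.
Hypothesis Fft : freely_transitive F.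
Hypothesis F'2 : two_transitive F'.
Implicit Types (v w x y u : T) (a b d e : Omega) (f : {perm Omega}).
Implicit Types (xi eta : tree_end T).
Local Notation nb := (neighbour c).
Local Notation word := (word c).
Local Notation walk := (walk c).
Local Notation branch := (branch c).
Local Notation lp := (local_perm c).
Local Notation G := (GFF_star_type c F F').
Local Notation is_elem := (@is_elem _ _ c F F').
Local Notation rist := (@rist _ _ c F F').
Local Notation fixator := (@fixator _ _ c F F').
Local Notation edir := (edir c).
Local Notation eray := (eray c).
Local Notation eword := (eword c).
Local Notation tail := (tail c).
Local Notation ell := (elliptic_stab c F F').
Local Notation bact := (boundary_action c F F').
Implicit Types (g h : G) (K : set G).

Lemma ell_act xi g h : ell (bact g xi) h -> ell xi (g^-1 * h * g).
Proof.
have E := ell_conj Fft g xi; move/(congr1 (@sub_set _)): E => /= <-.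
by move=> [k hk <-]; rewrite !mulgA mulVg mul1g mulgKV.
Qed.

Section Generation.
Variable K : set G.
Hypothesis Ks : is_subgroup K.

Let good xi := ell xi `<=` K.
Let spread u := exists xi eta, [/\ good xi, good eta & edir u xi <> edir u eta].

Let good_act g xi : K g -> good xi -> good (bact g xi).
Proof.
have [_ KM KV] := Ks; move=> Kg gx h /ell_act /gx Kh.
rewrite -(_ : g * (g^-1 * h * g) * g^-1 = h); last by rewrite !mulgA mulgV mul1g mulgK.
by apply: (KM); [exact: (KM)|exact: KV].
Qed.

Let spread_elem u s g : spread u -> s \in F' -> is_elem u s g -> K g.
Proof.
have [K1 KM KV] := Ks; move=> [xi [eta [gx ge ne]]] sF' gel.
pose M (f : {perm Omega}) := f \in F' /\ forall h, is_elem u f h -> K h.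
have Mfix zeta f : good zeta -> f \in F' -> f (edir u zeta) = edir u zeta -> M f.
  move=> gz fF' fz; split=> // h hf; apply: gz; apply/(ell_branch Fft).
  by exists u => x; exact: elem_fixes_branch hf fz.
suff [_] : M s by apply.
apply: (stabs_generate F'2 Om3 (introN eqP ne)) sF'.
- move=> f f' [fF' Mf] [fF'' Mf']; split=> [|h hf]; first exact: groupM.
  have [k kf] := elem_exists c sFF' Fft u fF'; have [k' kf'] := elem_exists c sFF' Fft u fF''.
  rewrite -(is_elem_uniq Fft (is_elemM kf kf') hf).
  by apply: KM; [exact: Mf'|exact: Mf].
- move=> f [fF' Mf]; split=> [|h /is_elemV]; first by rewrite groupV.
  by rewrite invgK => /Mf /KV; rewrite invgK.
- by move=> f; exact: Mfix.
- by move=> f; exact: Mfix.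
Qed.

Let spread_dir u d : spread u -> exists2 xi, good xi & edir u xi = d.
Proof.
move=> su; have [xi [_ [gx _ _]]] := su.
have [s sF' sd] := trans_pt (two_trans_trans F'2) (edir u xi) d.
have [k ke] := elem_exists c sFF' Fft u sF'.
exists (bact k xi); first by apply: good_act gx; exact: spread_elem ke.
by have [ku ks _] := ke; rewrite -{1}ku [LHS](edir_act c k) ks.
Qed.

Let spread_neighbour u d : spread u -> spread (nb u d).
Proof.
move=> su; have [xi gx xd] := spread_dir d su.
have [e ed] := other_colour Om3 d; have [eta ge ee] := spread_dir e su.
exists xi, eta; split=> //.
have -> : edir (nb u d) eta = d.
  apply: edir_sub ee => x bx; apply/branchC => bx'.
  by move: ed; rewrite (branch_disj bx bx') eqxx.
have -> : nb u d = eray xi u 1 by rewrite erayS -/(edir u xi) xd.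
rewrite edir_eray => E; have := eword_reduced c xi u 0.
by rewrite E -[eword xi u 0%N]/(edir u xi) xd eqxx.
Qed.

(** By conjugation, [K] contains the elliptic stabilisers of ends in two
    directions at some vertex, hence acts there as [F'], because two point
    stabilisers generate [F']. So it contains the elliptic stabilisers of
    ends in all directions, which carries the property to the neighbouring
    vertices. In the end [K] contains the fixators of all half-trees and
    acts as [F'] at every vertex, and these elements generate. *)
Lemma moves_end_full xi h : good xi -> K h -> bact h xi <> xi -> K = setT.
Proof.
have [K1 KM KV] := Ks.
move=> gx Kh hx; have [u0 u0P] := near_sep c hx.
have s0 : spread u0 by exists (bact h xi), xi; split=> //; exact: good_act.
have sp u : spread u.
  rewrite -(walk_word c u0 u); move: (word u0 u) => s.
  elim: s u0 {u0P} s0 => //= d s IH w sw.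
  by apply: IH; exact: spread_neighbour.
have fixK u d : fixator u d `<=` K.
  move=> g gf; have [eta ge ed] := spread_dir d (sp u).
  by apply: ge; apply/(ell_branch Fft); exists u; rewrite ed.
have mov v x : ~~ odd_dist c v x -> exists2 k, K k & k x = v.
  have [n] := ubnP (size (word v x)); elim: n x => // n IH x /ltnSE sn ox.
  move: sn ox; rewrite /odd_dist; have := walk_word c v x; have := word_reduced c v x.
  case: (word v x) => [|a [|b s]] // rs; first by exists 1.
  move=> xE /= sn; rewrite negbK => os.
  have ab : a <> b by move: rs; rewrite reduced_cons /= => /andP [+ _] E; rewrite E eqxx.
  have [t tF' tb] := trans_pt (two_trans_trans F'2) b a.
  (* An element of [K] fixing the second vertex of the path folds its third
     vertex onto [v]. *)
  have [k ke] := elem_exists c sFF' Fft (nb v a) tF'; have [ku kt _] := ke.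
  have ky : k (nb (nb v a) b) = v by rewrite aut_neighbour ku kt tb neighbourK.
  have wE : size (word v (k x)) = size s.
    rewrite -{1}ky word_aut size_lword -xE /= word_walk_reduced //.
    by move: rs; rewrite !reduced_cons => /and3P [].
  have [||k' Kk' k'E] := IH (k x).
  - by rewrite wE (leq_trans _ sn).
  - by rewrite /odd_dist wE.
  by exists (k' * k); [apply: KM => //; exact: spread_elem ke|rewrite GmulE].
apply/seteqP; split=> // g _; have [v] := tree_inhabited T.
have [_ _ tg] := GP g; have [k Kk kg] := mov v _ (type_preserving_odd c v tg).
have [gF' _ _] := GP (k * g).
have [e ee] := elem_exists c sFF' Fft v (gF' v); have [ev' es' _] := is_elemV ee.
have -> : g = k^-1 * (e * (e^-1 * (k * g))) by rewrite mulKVg mulKg.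
apply: (KM _ _ (KV _ Kk)); apply: (KM); first exact: spread_elem (gF' v) ee.
apply: (@split_star _ _ _ _ _ _ v) => //.
- by rewrite !GmulE kg ev'.
- by rewrite local_permM [(GFF_val _) v]kg es' mulgV.
move=> b l lr _ _; apply: (fixK (nb v b) b).
by rewrite -rist_neighbour neighbourK.
Qed.
End Generation.

Section Positions.

(** A diagonal argument: the colour of index [n.+1] is chosen different from
    that of the [n]-th end to be avoided. *)
Lemma avoid_ends (L : seq (tree_end T)) u a :
  exists2 eta, edir u eta = a & forall xi, xi \in L -> eta <> xi.
Proof.
have [xi0 _] := generic_exists c F' Om3 Fft.
pose q n := eword (nth xi0 L n) u n.+1.
have choice b d : exists e, e != b /\ e != d.
  by have [e eb ed] := third_colour Om3 b d; exists e.
pose p := fix p n := if n is m.+1 then projT1 (cid (choice (p m) (q m))) else a.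
have pS n : p n.+1 != p n /\ p n.+1 != q n by rewrite /=; case: cid.
have ip : ireduced p by move=> n; have [h _] := pS n; rewrite eq_sym.
have [eta etaE] := end_of_word c u ip; exists eta; first by rewrite /edir etaE.
move=> xi xiL E; have [_] := pS (index xi L).
by rewrite /q nth_index // -E etaE eqxx.
Qed.

(** At a vertex moved by [g], take an edge that does not lead towards the
    image of this vertex, and whose own image does not lead back. *)
Lemma moved_branch g : g <> 1 ->
  exists z a, forall x, branch z a x -> ~ branch z a (g x).
Proof.
move=> g1; have [y gy] : exists y, g y <> y.
  apply: contrapT => /forallNP h; apply: g1; apply: G_ext => x.
  exact: contrapT (h x).
have [//|[a0 b0]] := branch_cases c y (g y).
have [E|[a1 b1]] := branch_cases c (g y) y; first by case: gy.
have [a aa0 aa1] := third_colour Om3 a0 ((lp g y)^-1 a1).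
exists y, a => x bx bgx.
have : branch (g y) a1 (g x).
  apply: (branch_far b0 b1) => h; move: aa0; rewrite (branch_disj bgx h) eqxx //.
have := (branch_aut c g y a x).2 bx => h1 h2.
by move: aa1; rewrite -(branch_disj h1 h2) permK eqxx.
Qed.

Lemma choose_ends (I : finType) (z : I -> T) (e : I -> Omega) (Q : seq G) (l : seq I) :
  uniq l -> exists xi : I -> tree_end T,
    (forall k, k \in l -> edir (z k) (xi k) = e k) /\
    forall k k', k \in l -> k' \in l -> k != k' ->
      forall g, g \in Q -> xi k <> bact g (xi k').
Proof.
elim: l => [_|k l IH /= /andP [kl ul]].
  by have [xi0 _] := generic_exists c F' Om3 Fft; exists (fun=> xi0).
have [xi [xi1 xi2]] := IH ul.
pose L := [seq bact g (xi j) | g <- Q ++ map (fun g => g^-1) Q, j <- l].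
have [eta etad etaL] := avoid_ends L (z k) (e k).
exists (fun j => if j == k then eta else xi j); split=> [j|j j'].
  by rewrite inE; case: eqVneq => [->|_] //=; exact: xi1.
rewrite !inE; case: eqVneq => [->|jk]; case: eqVneq => [->|j'k] //=; rewrite ?eqxx //.
- move=> _ j'l _ g gQ; apply: etaL; apply/allpairsP; exists (g, j'); split=> //=.
  by rewrite mem_cat gQ.
- move=> jl _ _ g gQ E; apply: (etaL (bact g^-1 (xi j))).
    apply/allpairsP; exists (g^-1, j); split=> //=.
    by rewrite mem_cat map_f ?orbT.
  by rewrite E -hactM mulVg hact1.
- by move=> jl j'l jj g gQ; exact: xi2.
Qed.

(** Half-trees that are small enough around ends in general position. *)
Lemma positions (I : finType) (p : I -> G) (Q : seq G) : (forall k, p k <> 1) ->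
  exists y : I -> T, exists b : I -> Omega,
    (forall k x, branch (y k) (b k) x -> ~ branch (y k) (b k) (p k x)) /\
    forall k l g, k != l -> g \in Q -> forall x, branch (y l) (b l) x ->
      ~ branch (y k) (b k) (g x).
Proof.
move=> p1.
pose z k := projT1 (cid (moved_branch (p1 k))).
have zE k : exists a, forall x, branch (z k) a x -> ~ branch (z k) a (p k x).
  by rewrite /z; case: cid.
pose e k := projT1 (cid (zE k)).
have eP k x : branch (z k) (e k) x -> ~ branch (z k) (e k) (p k x).
  by rewrite /e; case: cid => a; apply.
have [xi [xi1 xi2]] := @choose_ends I z e Q (enum I) (enum_uniq I).
have [v] := tree_inhabited T.
have sep k l g : k != l -> g \in Q -> exists N, forall n, (N <= n)%N ->
    forall x, tail (xi l) v n x -> ~ tail (xi k) v n (g x).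
  move=> kl gQ; have [u ne] := near_sep c (xi2 k l (mem_enum _ _) (mem_enum _ _) kl g gQ).
  have [N NP] := tail_sub c (xi k) v u; have [M MP] := tail_sub c (xi l) v (g^-1 u).
  exists (maxn N M) => n; rewrite geq_max => /andP [Nn Mn] x /(MP n Mn) hl /(NP n Nn) hk.
  apply: ne; apply: (branch_disj hk).
  have E := edir_act c g (xi l) (g^-1 u); rewrite GKinv in E.
  rewrite [edir u (bact g (xi l))]E -{1}(GKinv g u); exact/branch_aut.
have [N NP] : exists N, forall kl : I * I, tail (xi kl.1) v N `<=` branch (z kl.1) (e kl.1) /\
    (kl.1 != kl.2 -> forall g, g \in Q -> forall x, tail (xi kl.2) v N x ->
       ~ tail (xi kl.1) v N (g x)).
  apply: (@eventually_all _ (fun kl n => tail (xi kl.1) v n `<=` branch (z kl.1) (e kl.1) /\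
    (kl.1 != kl.2 -> forall g, g \in Q -> forall x, tail (xi kl.2) v n x ->
       ~ tail (xi kl.1) v n (g x)))) => -[k l] /=.
  have [N NP] := tail_sub c (xi k) v (z k); rewrite xi1 ?mem_enum // in NP.
  have [kl|kl] := eqVneq k l; first by exists N => n /NP.
  have [M MP] : exists M, forall n, (M <= n)%N -> forall g, g \in Q -> forall x,
      tail (xi l) v n x -> ~ tail (xi k) v n (g x).
    have : {subset Q <= Q} by [].
    elim: {-2}Q => [|g Q' IH] sQ; first by exists 0%N.
    have [|M MP] := IH; first by move=> h hQ; apply: sQ; rewrite inE hQ orbT.
    have [|M' MP'] := sep k l g kl; first by apply: sQ; rewrite inE eqxx.
    exists (maxn M M') => n; rewrite geq_max => /andP [Mn Mn'] h; rewrite inE.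
    by move=> /orP [/eqP ->|]; [exact: MP'|exact: MP].
  exists (maxn N M) => n; rewrite geq_max => /andP [/NP Nn /MP Mn]; split=> // _.
exists (fun k => eray (xi k) v N), (fun k => eword (xi k) v N).
split=> [k x tx tpx|k l g kl gQ x].
  have [sub _] := NP (k, k); exact: eP (sub _ tx) (sub _ tpx).
by have [_] := NP (k, l); apply.
Qed.

Lemma rist_prod (J : finType) (y : J -> T) (b : J -> Omega) (la : J -> G) :
  (forall j k x, j != k -> branch (y j) (b j) x -> ~ branch (y k) (b k) x) ->
  (forall j, rist (y j) (b j) (la j)) ->
  exists g, (forall j x, branch (y j) (b j) x -> g x = la j x) /\
    forall x, (forall j, ~ branch (y j) (b j) x) -> g x = x.
Proof.
move=> dis lar.
have [g [g1 g2]] : exists g, (forall j x, j \in enum J -> branch (y j) (b j) x -> g x = la j x) /\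
    forall x, (forall j, j \in enum J -> ~ branch (y j) (b j) x) -> g x = x.
  elim: (enum J) (enum_uniq J) => [_|k l IH /= /andP [kl /IH [g [g1 g2]]]]; first by exists 1.
  exists (la k * g); split=> [j x|x h].
    rewrite inE => /orP [/eqP -> bx|jl bx].
      rewrite GmulE g2 // => i il; apply: dis bx.
      by apply: contraNneq kl => ->.
    have jk : j != k by apply: contraNneq kl => <-.
    rewrite GmulE (g1 j) //; apply: (lar k); apply: (dis j) => //.
    by apply: rist_pres bx; exact: lar.
  rewrite GmulE g2; last by move=> j jl; apply: h; rewrite inE jl orbT.
  by apply: (lar k); apply: h; rewrite inE eqxx.
exists g; split=> [j x|x h]; first by apply: g1; rewrite mem_enum.
by apply: g2 => j _; exact: h.
Qed.

End Positions.

Lemma disjoint_commute g h : (forall x, g x = x \/ h x = x) -> g * h = h * g.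
Proof.
move=> d; apply: G_ext => x; rewrite !GmulE.
have [gx|hx] := d x.
  rewrite gx; have [//|hhx] := d (h x).
  by rewrite (aut_inj hhx) gx.
rewrite hx; have [ggx|-> //] := d (g x).
by rewrite (aut_inj ggx) hx.
Qed.

Lemma commutator_disjoint (x y r r' : G) : r * y = y * r -> r * x = x * r ->
  r' * x = x * r' -> r' * y = y * r' -> r * r' = r' * r ->
  (x * r) * (y * r') * (x * r)^-1 * (y * r')^-1 = x * y * x^-1 * y^-1.
Proof.
move=> ry rx r'x r'y rr'.
have E : (x * r) * (y * r') = (x * y) * (r' * r).
  by rewrite -!mulgA; congr (_ * _); rewrite mulgA ry -mulgA rr'.
have Ex : (x * r)^-1 = r^-1 * x^-1 by rewrite invgM.
have Ey : (y * r')^-1 = y^-1 * r'^-1 by rewrite -r'y invgM.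
have r'xV : r' * x^-1 = x^-1 * r' by apply: (mulgI x); rewrite mulgA -r'x mulgK mulKVg.
have r'yV : r' * y^-1 = y^-1 * r' by apply: (mulgI y); rewrite mulgA -r'y mulgK mulKVg.
rewrite E Ex Ey !mulgA -(mulgA _ r r^-1) mulgV mulg1 -(mulgA _ r' x^-1) r'xV !mulgA.
by rewrite -(mulgA _ r' y^-1) r'yV !mulgA mulgK.
Qed.

Section Kappa.
Variables (v : T) (a : Omega) (E : set T) (p la x g h : G).
Let A := branch v a.
Hypotheses (lar : rist v a la) (xr : rist v a x).
Hypotheses (gA : forall z, A z -> g z = la z) (hA : forall z, A z -> h z = la (x z)).
Hypotheses (gO : forall z, ~ A z -> ~ E z -> g z = z) (hO : forall z, ~ A z -> ~ E z -> h z = z).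
Hypotheses (pA : forall z, A z -> ~ A (p z)) (pE : forall z, E z -> ~ A (p z)).
(** If [g] and [h] act on the half-tree [A] as [la] and [la * x], then the
    quotient [kappa] of the conjugates of [p] by [g] and [h] acts on [A] as [x],
    since [p] moves both [A] and the junk set [E] off [A]; on the image of [A]
    under [p] it acts through [la * x^-1 * la^-1]. *)
Definition kappa := g^-1 * p * g * h^-1 * p^-1 * h.

Let inv (k : G) z w : k w = z -> k^-1 z = w.
Proof. by move=> <-; rewrite GinvK. Qed.

Lemma kappa_in z : A z -> kappa z = x z.
Proof.
move=> Az; have Axz := rist_pres xr Az; have Alxz := rist_pres lar Axz.
rewrite /kappa !GmulE (hA Az); set w := p^-1 (la (x z)).
have pw : p w = la (x z) by rewrite GKinv.
have nAw : ~ A w by move=> /pA; rewrite pw.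
have nEw : ~ E w by move=> /pE; rewrite pw.
rewrite (inv (hO nAw nEw)) (gO nAw nEw) pw.
by apply: inv; rewrite gA.
Qed.

Lemma kappa_out z : ~ A z -> ~ E z -> ~ E (p^-1 z) ->
  (A (p^-1 z) -> la (x^-1 (la^-1 (p^-1 z))) = p^-1 z) -> kappa z = z.
Proof.
move=> nAz nEz nEw fw; rewrite /kappa !GmulE (hO nAz nEz).
set w := p^-1 z in nEw fw *.
have -> : g (h^-1 w) = w.
  have [Aw|nAw] := pselect (A w); last by rewrite (inv (hO nAw nEw)) gO.
  pose t := x^-1 (la^-1 w).
  have At : A t.
    have [_ _ V] := rist_subgroup c F F' v a.
    by apply: (rist_pres (V _ xr)); apply: (rist_pres (V _ lar)).
  have -> : h^-1 w = t by apply: inv; rewrite hA // /t !GKinv.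
  by rewrite gA // fw.
by rewrite GKinv; apply: inv; rewrite gO.
Qed.

(** The junk part of [kappa], trivial on [A]. *)
Definition kappa_rest := x^-1 * kappa.

Lemma kappaE : kappa = x * kappa_rest.
Proof. by rewrite /kappa_rest mulKVg. Qed.

Lemma kappa_rest_in z : A z -> kappa_rest z = z.
Proof. by move=> Az; rewrite /kappa_rest GmulE kappa_in // GinvK. Qed.

Lemma kappa_rest_out z : ~ A z -> ~ E z -> ~ E (p^-1 z) ->
  (A (p^-1 z) -> la (x^-1 (la^-1 (p^-1 z))) = p^-1 z) -> kappa_rest z = z.
Proof.
move=> nAz nEz nEw fw; rewrite /kappa_rest GmulE kappa_out //.
by apply: inv; exact: xr.
Qed.
End Kappa.

End Main.

(** * Confined subgroups contain rigid stabilisers *)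

Section Confined.
Local Open Scope group_scope.
Variables (Omega : finType) (T : tree) (c : legal_colouring Omega T).
Variables (F F' : {group {perm Omega}}).
Hypothesis Om3 : (2 < #|Omega|)%N.
Hypothesis sFF' : F \subset F'.
Hypothesis Fft : freely_transitive F.
Hypothesis F'2 : two_transitive F'.
Implicit Types (v w x y u z : T) (a d e : Omega) (f : {perm Omega}).
Local Notation nb := (neighbour c).
Local Notation branch := (branch c).
Local Notation lp := (local_perm c).
Local Notation G := (GFF_star_type c F F').
Local Notation is_elem := (@is_elem _ _ c F F').
Local Notation rist := (@rist _ _ c F F').
Implicit Types (g h : G).
Variables (U : set (sub_space G)) (K : sub_space G).
Hypotheses (iU : conj_invariant U) (UK : U K).
Variables (n : nat) (p : 'I_n.+2 -> G).
Hypotheses (p1 : forall i, p i <> 1).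
Hypothesis pU : forall H, U H -> exists i, sub_set H (p i).

Section Colour.
Variables (J : finType) (q : J -> G) (y : J -> T) (b : J -> Omega).
Hypothesis qU : forall H, U H -> exists j, sub_set H (q j).
Local Notation A j := (branch (y j) (b j)).
Hypothesis dis : forall j k z, j != k -> A j z -> ~ A k z.

(** The elements [g] of the product of the rigid stabilisers of the
    half-trees [A j] are coloured by the [j] such that [g^-1 * q j * g] lies
    in [K]. The colour class of [j] has to project onto the factor [j]: this
    is what makes the quotients of two such conjugates flexible on [A j]. *)
Definition selects j := forall la, rist (y j) (b j) la -> exists g,
  [/\ forall z, A j z -> g z = la z,
      forall z, (forall k, ~ A k z) -> g z = z
    & sub_set K (g^-1 * q j * g)].

(** If every colour class [j] missed some element [la j] of the factor [j],
    then the product of all these elements would have no colour. *)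
Lemma select_exists : exists j, selects j.
Proof.
apply: contrapT => /forallNP no.
have bad j : exists la, rist (y j) (b j) la /\ ~ exists g,
  [/\ forall z, A j z -> g z = la z,
      forall z, (forall k, ~ A k z) -> g z = z
    & sub_set K (g^-1 * q j * g)].
  apply: contrapT => /forallNP h; apply: (no j) => la lar.
  by apply: contrapT => h'; apply: (h la).
pose la j := projT1 (cid (bad j)).
have laP j : rist (y j) (b j) (la j) /\ ~ exists g,
  [/\ forall z, A j z -> g z = la j z,
      forall z, (forall k, ~ A k z) -> g z = z
    & sub_set K (g^-1 * q j * g)].
  by rewrite /la; case: cid.
have [g [g1 g2]] := rist_prod dis (fun j => (laP j).1).
have [j [h Kh hj]] := qU (iU g UK).
have [_] := laP j; apply; exists g; split=> //; first exact: g1.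
by rewrite -hj -!mulgA mulVg mulg1 mulKg.
Qed.
End Colour.

(** The half-trees are indexed by a colour [i] and a second index. For each
    choice [m] of second indices some colour is selected; take [m] and [m']
    with the same colour [i], agreeing exactly at [i]. Given [x] and [x'] in
    the rigid stabiliser of a smaller half-tree, the corresponding elements
    [kappa] of [K] act there as [x] and [x'], and their junk parts have
    disjoint supports; so the commutator of these elements is that of [x]
    and [x']. *)
Lemma contains_commutators : exists v a,
  forall g h, rist v a g -> rist v a h -> sub_set K (g * h * g^-1 * h^-1).
Proof.
have [K1 KM KV] := Defs.sub_setP K.
pose I : finType := ('I_n.+2 * 'I_n.+3)%type.
pose Q := 1 :: [seq p i | i : 'I_n.+2].
have [y [b [pk gen]]] := @positions _ _ c _ _ Om3 Fft I (fun k => p k.1) Q (fun k => @p1 k.1).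
have pQ i : p i \in Q by rewrite inE; apply/orP; right; exact: codom_f.
pose A k := branch (y k) (b k).
have dis k l z : k != l -> A k z -> ~ A l z.
  by move=> kl Az; apply: (gen l k 1); rewrite ?inE ?eqxx // eq_sym.
pose ym (m : {ffun 'I_n.+2 -> 'I_n.+3}) i := y (i, m i).
pose bm (m : {ffun 'I_n.+2 -> 'I_n.+3}) i := b (i, m i).
have dism m j k z : j != k -> branch (ym m j) (bm m j) z -> ~ branch (ym m k) (bm m k) z.
  by move=> jk; apply: dis; rewrite xpair_eqE negb_and jk.
have sel m := select_exists pU (dism m).
pose chi m := projT1 (cid (sel m)).
have chiP m : selects p (ym m) (bm m) (chi m) by rewrite /chi; case: cid.
have [m [m' [Echi agree]]] := diagonal_colouring chi.
set i := chi m in agree.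
have mi : m i = m' i by apply/eqP; rewrite agree.
have S1 : selects p (ym m) (bm m) i by exact: chiP.
have S2 : selects p (ym m') (bm m') i by rewrite /i Echi; exact: chiP.
pose v := y (i, m i); pose a := b (i, m i).
have ev : ((ym m' i = v) * (bm m' i = a))%type by rewrite /ym /bm -mi.
pose E (mm : {ffun 'I_n.+2 -> 'I_n.+3}) z := exists2 j, j != i & A (j, mm j) z.
have AE (mm : {ffun 'I_n.+2 -> 'I_n.+3}) z : mm i = m i -> A (i, m i) z -> ~ E mm z.
  move=> e Az [j ji]; apply: (dis (i, m i)) => //.
  by rewrite xpair_eqE negb_and eq_sym ji.
have EE z : E m z -> ~ E m' z.
  move=> [j ji Az] [k ki]; apply: dis Az; rewrite xpair_eqE negb_and.
  by case: eqVneq => //= ->; rewrite agree ki.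
have pEE (mm mm' : {ffun 'I_n.+2 -> 'I_n.+3}) z : (mm = m /\ mm' = m') \/ (mm = m' /\ mm' = m) ->
    E mm z -> ~ E mm' (p i z).
  move=> em [j ji Az] [k ki]; apply: gen Az => //; rewrite xpair_eqE negb_and.
  case: eqVneq => //= ->; case: em => -[-> ->]; first by rewrite eq_sym agree.
  by rewrite agree.
have pA z : A (i, m i) z -> ~ A (i, m i) (p i z) by exact: (pk (i, m i)).
have pE (mm : {ffun 'I_n.+2 -> 'I_n.+3}) z : E mm z -> ~ A (i, m i) (p i z).
  move=> [j ji Az]; apply: gen Az => //.
  by rewrite xpair_eqE negb_and eq_sym ji.
have ApE (mm : {ffun 'I_n.+2 -> 'I_n.+3}) z : A (i, m i) z -> ~ E mm (p i z).
  move=> Az [j ji]; apply: gen Az => //.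
  by rewrite xpair_eqE negb_and ji.
pose w := nb v a.
have [d da] := other_colour Om3 a; have [d' d'a d'd] := third_colour Om3 a d.
have [s [sF' sa sd]] := two_trans_stab F'2 da d'a.
(* [la] moves the half-tree [branch w d] off itself, so that [x] and [la *
   x^-1 * la^-1], which appears on the image under [p i], have disjoint
   supports. *)
have [la lae] := elem_exists c sFF' Fft w sF'; have [law las _] := lae.
have lar : rist v a la by move=> z /branchC; exact: elem_fixes_branch lae sa.
have subA : branch w d `<=` branch v a by apply: sub_branch; exact/eqP.
have la_off z : branch w d z -> ~ branch w d (la z).
  move=> bz bz'; have := (branch_aut c la w d z).2 bz; rewrite law las sd => bz''.
  by move: d'd; rewrite (branch_disj bz'' bz') eqxx.
exists w, d => x x' xr x'r.
have xrA : rist v a x by exact: sub_rist xr.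
have x'rA : rist v a x' by exact: sub_rist x'r.
have [r1 rM rV] := rist_subgroup c F F' v a.
have [g [gA gO Kg]] := S1 la lar.
have [h [hA hO Kh]] := S1 (la * x) (rM _ _ lar xrA).
move: S2; rewrite /selects ev.1 ev.2 => S2.
have [g' [g'A g'O Kg']] := S2 1 r1.
have [h' [h'A h'O Kh']] := S2 x' x'rA.
have out (mm : {ffun 'I_n.+2 -> 'I_n.+3}) z : mm i = m i -> ~ branch v a z ->
    ~ E mm z -> forall k, ~ A (k, mm k) z.
  move=> e nA nE k Az; have [ki|ki] := eqVneq k i; last by apply: nE; exists k.
  by apply: nA; move: Az; rewrite ki e.
pose ka := kappa (p i) g h; pose ka' := kappa (p i) g' h'.
have Kka : sub_set K ka.
  rewrite /ka /kappa (_ : _ * h = (g^-1 * p i * g) * (h^-1 * p i * h)^-1).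
    by apply: (KM) => //; exact: KV.
  by rewrite !invgM invgK !mulgA.
have Kka' : sub_set K ka'.
  rewrite /ka' /kappa (_ : _ * h' = (g'^-1 * p i * g') * (h'^-1 * p i * h')^-1).
    by apply: (KM) => //; exact: KV.
  by rewrite !invgM invgK !mulgA.
have r_in z : branch v a z -> kappa_rest (p i) x g h z = z.
  apply: (@kappa_rest_in _ _ c F F' v a (E m) (p i) la x g h) => //.
  - by move=> t nA nE; apply: gO; exact: out.
  - by move=> t nA nE; apply: hO; exact: out.
  - exact: pE.
have r_out z : ~ branch v a z -> ~ E m z -> ~ E m ((p i)^-1 z) ->
    (branch v a ((p i)^-1 z) -> ~ branch w d (la^-1 ((p i)^-1 z))) ->
    kappa_rest (p i) x g h z = z.
  move=> nA nE nE' nw.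
  apply: (@kappa_rest_out _ _ c F F' v a (E m) (p i) la x g h) => //.
  - by move=> t nAt nEt; apply: gO; exact: out.
  - by move=> t nAt nEt; apply: hO; exact: out.
  - move=> /nw nw'; have [_ _ V] := rist_subgroup c F F' w d.
    by rewrite (V _ xr) // GKinv.
have r'_in z : branch v a z -> kappa_rest (p i) x' g' h' z = z.
  apply: (@kappa_rest_in _ _ c F F' v a (E m') (p i) 1 x' g' h') => //.
  - by move=> t nA nE; apply: g'O; exact: out.
  - by move=> t nA nE; apply: h'O; exact: out.
  - exact: pE.
have r'_out z : ~ branch v a z -> ~ E m' z -> ~ E m' ((p i)^-1 z) ->
    ~ branch w d ((p i)^-1 z) -> kappa_rest (p i) x' g' h' z = z.
  move=> nA nE nE' nw.
  apply: (@kappa_rest_out _ _ c F F' v a (E m') (p i) 1 x' g' h') => //.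
  - by move=> t nAt nEt; apply: g'O; exact: out.
  - by move=> t nAt nEt; apply: h'O; exact: out.
  - move=> _; have [_ _ V] := rist_subgroup c F F' w d.
    by rewrite invg1; exact: (V _ x'r _ nw).
have in_fix (k l : G) : rist w d k -> (forall z, branch v a z -> l z = z) -> l * k = k * l.
  move=> kr lA; apply: disjoint_commute => z.
  by have [/lA|nA] := pselect (branch v a z); [left|right; apply: kr => /subA].
rewrite -(@commutator_disjoint _ _ c F F' x x'
  (kappa_rest (p i) x g h) (kappa_rest (p i) x' g' h')).
- rewrite -!kappaE; apply: (KM); last exact: KV.
  by apply: (KM); [exact: (KM)|exact: KV].
- exact: in_fix.
- exact: in_fix.
- exact: in_fix.
- exact: in_fix.
apply: disjoint_commute => z; apply: contrapT => /not_orP [m1 m2].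
have nA : ~ branch v a z by move=> /r_in.
have pz : p i ((p i)^-1 z) = z by exact: GKinv.
(* A point moved by both junk parts would lie in two half-trees that are
   disjoint by the choice of positions, of [m] and [m'], or of [la]. *)
have c1 : E m z \/ E m ((p i)^-1 z) \/
    (branch v a ((p i)^-1 z) /\ branch w d (la^-1 ((p i)^-1 z))).
  apply: contrapT => /not_orP [n1 /not_orP [n2 n3]]; apply: m1; apply: r_out => // bA bw.
  by apply: n3.
have c2 : E m' z \/ E m' ((p i)^-1 z) \/ branch w d ((p i)^-1 z).
  by apply: contrapT => /not_orP [n1 /not_orP [n2 n3]]; apply: m2; exact: r'_out.
case: c1 => [E1|[E1|[A1 w1]]]; case: c2 => [E2|[E2|w2]].
- exact: EE E1 E2.
- by apply: (pEE m' m _ _ E2); [right|rewrite pz].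
- by apply: (ApE m _ (subA _ w2)); rewrite pz.
- by apply: (pEE m m' _ _ E1); [left|rewrite pz].
- exact: EE E1 E2.
- exact: AE (subA _ w2) E1.
- by apply: (ApE m' _ A1); rewrite pz.
- by apply: AE A1 E2; rewrite mi.
- by apply: (la_off _ w1); rewrite GKinv.
Qed.

End Confined.

(** * Classification of the uniformly recurrent subgroups *)

Section Classification.
Local Open Scope group_scope.

Lemma singleton_URS (G : groupType) (N : sub_space G) :
  (forall g, conj_sub g N = N) -> is_URS [set N].
Proof.
move=> cN; split; [by exists N|exact: sub_sing_closed|by move=> g _ ->|].
by move=> V [H VH] _ _ sV; apply/seteqP; split=> // _ ->; rewrite -(sV _ VH).
Qed.

Lemma trivial_URS_URS (G : groupType) : is_URS (trivial_URS G).
Proof.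
apply: singleton_URS => g; apply: sub_space_ext; apply/seteqP; split=> [_ [_ -> <-]|_ ->] /=.
  by rewrite mulg1 mulgV.
by exists 1 => //; rewrite mulg1 mulgV.
Qed.

Lemma full_URS_URS (G : groupType) : is_URS (full_URS G).
Proof.
apply: singleton_URS => g; apply: sub_space_ext; apply/seteqP; split=> h //= _.
by exists (g^-1 * h * g) => //; rewrite !mulgA mulgV mul1g mulgK.
Qed.

Lemma URS_eq (G : groupType) (U V : set (sub_space G)) :
  is_URS U -> is_URS V -> V `<=` U -> U = V.
Proof. by move=> [_ _ _ minU] [V0 cV iV _] /(minU _ V0 cV iV). Qed.

Variables (Omega : finType) (T : tree) (c : legal_colouring Omega T).
Variables (F F' : {group {perm Omega}}).
Hypothesis Om3 : (2 < #|Omega|)%N.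
Hypothesis sFF' : F \subset F'.
Hypothesis Fft : freely_transitive F.
Hypothesis F'2 : two_transitive F'.
Hypothesis F'perf : perfect_point_stabilizers F'.
Local Notation G := (GFF_star_type c F F').
Local Notation rist := (@rist _ _ c F F').
Local Notation eray := (eray c).
Local Notation eword := (eword c).
Local Notation tail := (tail c).
Local Notation bact := (boundary_action c F F').
Local Notation S := (stabilizer_URS bact).
Implicit Types (g h : G) (U : set (sub_space G)).

Lemma nontrivial_contains_rist U K : is_URS U -> U <> trivial_URS G -> U K ->
  exists v a, rist v a `<=` sub_set K.
Proof.
move=> UU U1 UK; have [_ cU iU _] := UU.
have nU : ~ U (SubSpace (trivial_is_subgroup G)).
  by move=> h; apply: U1; apply: URS_eq => //; [exact: trivial_URS_URS|move=> _ ->].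
have [D [D1 DU]] := confined cU nU.
have [p0 p0D _] := DU _ UK.
(* Two repeated entries ensure that there are at least two indices. *)
pose p (i : 'I_(size D).+2) := nth p0 D i.
have pD i : p i \in D.
  by have [h|h] := ltnP i (size D); [exact: mem_nth|rewrite /p nth_default].
have pU H : U H -> exists i, sub_set H (p i).
  move=> /DU [g gD Hg].
  have h : (index g D < (size D).+2)%N by rewrite ltnS ltnW // ltnS index_size.
  by exists (Ordinal h); rewrite /p nth_index.
have [v [a com]] := contains_commutators Om3 sFF' Fft F'2 iU UK (fun i => D1 _ (pD i)) pU.
by exists v, a; apply: rist_perfect => //; exact: Defs.sub_setP.
Qed.

(** Conjugating a half-tree towards an end, its rigid stabilisers exhaust
    the elliptic stabiliser of this end; a limit of the conjugates contains
    them all. *)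
Lemma nontrivial_contains_ell U xi : is_URS U -> U <> trivial_URS G ->
  exists2 H, U H & elliptic_stab c F F' xi `<=` sub_set H.
Proof.
move=> UU U1; have [[K UK] cU iU _] := UU.
have [w [b Krist]] := nontrivial_contains_rist UU U1 UK.
have gE n : exists g : G,
    rist (eray xi w n.*2.+2) (eword xi w n.*2.+1) `<=` sub_set (conj_sub g K).
  have [f fF fb] := trans_pt Fft.1 b (eword xi w n.*2.+1).
  have ow : ~~ odd_dist c w (eray xi w n.*2.+2).
    rewrite /odd_dist word_iwalk ?size_mkseq /= ?odd_double //.
    exact: eword_reduced.
  have [g [gw gl]] := trans_G sFF' fF ow.
  exists g => h hr; exists (g^-1 * h * g); last by rewrite !mulgA mulgV mul1g mulgK.
  apply: Krist => x bx; rewrite !GmulE hr ?GinvK // -gw -fb -(gl w).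
  by apply: contra_not bx => /branch_aut.
pose g n := projT1 (cid (gE n)).
have [H UH Hlim] := sub_limit cU (fun n => iU (g n) K UK).
exists H => // h /(ell_tail Fft xi w) [N NP]; apply: Hlim; exists N => n Nn.
have /(_ h) : rist (eray xi w n.*2.+2) (eword xi w n.*2.+1) `<=` sub_set (conj_sub (g n) K).
  by rewrite /g; case: cid.
apply; rewrite erayS rist_neighbour => x; apply: NP.
by rewrite leqW // (leq_trans Nn) // -addnn leq_addr.
Qed.

(** Some member contains the elliptic stabiliser of a generic end [xi]. If
    it fixes [xi], then it equals this stabiliser, because no hyperbolic
    element fixes [xi]; otherwise it is everything. *)
Lemma URS_classification U : is_URS U ->
  [\/ U = trivial_URS G, U = S | U = full_URS G].
Proof.
move=> UU; have [E|U1] := pselect (U = trivial_URS G); first by constructor 1.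
have [xi gx] := generic_exists c F' Om3 Fft.
have [H UH xiH] := nontrivial_contains_ell xi UU U1.
have [_ cU iU _] := UU.
have [fixxi|] := pselect (forall h, sub_set H h -> bact h xi = xi).
  constructor 2; apply: URS_eq => //; first exact: stabilizer_URS_URS.
  rewrite stabilizer_URSE // => _ [eta ->]; apply: (orbit_closure sFF' (xi := xi)) => //.
  suff <- : H = ell c F' Fft xi by [].
  apply: sub_space_ext; apply/seteqP; split=> // h Hh.
  by split; [apply: gx|]; exact: fixxi.
move=> /existsNP [h /not_implyP [Hh hxi]].
constructor 3; apply: URS_eq => //; first exact: full_URS_URS.
move=> _ ->; suff <- : H = SubSpace (full_is_subgroup G) by [].
apply: sub_space_ext; apply: (moves_end_full Om3 sFF' Fft F'2 (Defs.sub_setP H) xiH Hh hxi).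
Qed.

End Classification.

Theorem theorem1p11
  (R : realType)
  (Omega : finType) (F F' : {group {perm Omega}})
  (Omega_gt3 : (3 < #|Omega|)%N)
  (sFF' : F \subset F')
  (F_free_trans : freely_transitive F)
  (F'_2trans : two_transitive F')
  (F'_perfect : perfect_point_stabilizers F')
  (T : tree) (T_regular : regular_tree #|Omega| T)
  (c : legal_colouring Omega T) :
  let G := GFF_star_type c F F' in
  let S := stabilizer_URS (boundary_action c F F') in
  ((forall U : set (sub_space G),
      is_URS U <-> [\/ U = trivial_URS G, U = S | U = full_URS G]) /\
   [/\ trivial_URS G <> S, S <> full_URS G & trivial_URS G <> full_URS G]) /\
  ((forall U : set (sub_space G),
      [/\ is_URS U, amenable_URS R U & U <> trivial_URS G] <-> U = S) /\
   (forall xi : tree_end T,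
      [/\ is_subgroup (elliptic_stab c F F' xi),
          infinite_set (elliptic_stab c F F' xi)
        & locally_finite (elliptic_stab c F F' xi)]) /\
   S = [set H | exists xi : tree_end T, sub_set H = elliptic_stab c F F' xi]).
Proof.
move=> G S.
have Om3 : (2 < #|Omega|)%N := ltnW Omega_gt3.
have SE : S = [set H | exists xi, H = ell c F' F_free_trans xi].
  exact: stabilizer_URSE.
have SU : is_URS S by exact: stabilizer_URS_URS.
have [xi0 _] := generic_exists c F' Om3 F_free_trans.
have Sxi0 : S (ell c F' F_free_trans xi0) by rewrite SE; exists xi0.
have inf xi : infinite_set (elliptic_stab c F F' xi) by exact: ell_infinite.
have namen : ~ amenable R [set: G] by exact: G_not_amenable.
have Samen : amenable_URS R S.
  by rewrite SE => _ [xi ->]; exact: ell_amenable.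
have fullamen : ~ amenable_URS R (full_URS G).
  by move=> /(_ _ erefl).
have trivS : trivial_URS G <> S.
  move=> E; have := Sxi0; rewrite -E => /(congr1 (@sub_set G)) /= E1.
  by apply: (inf xi0); rewrite E1; exact: finite_set1.
have Sfull : S <> full_URS G by move=> E; apply: fullamen; rewrite -E.
have trivfull : trivial_URS G <> full_URS G.
  move=> E; have : full_URS G (SubSpace (trivial_is_subgroup G)) by rewrite -E.
  move=> /(congr1 (@sub_set G)) /= E1; apply: (inf xi0).
  by apply: (@sub_finite_set _ _ [set (1%g : G)]); [rewrite E1|exact: finite_set1].
split; split.
- move=> U; split=> [UU|]; first exact: URS_classification.
  by case=> ->; [exact: trivial_URS_URS|exact: SU|exact: full_URS_URS].
- by split.
- move=> U; split=> [[UU Uam U1]|->]; last by split=> // E; apply: trivS.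
  have [//|//|E] := URS_classification Om3 sFF' F_free_trans F'_2trans F'_perfect UU.
  by case: fullamen; rewrite -E.
split=> [xi|].
  by split; [exact: ell_subgroup|exact: inf|exact: ell_locally_finite].
rewrite SE; apply/seteqP; split=> H [xi E]; exists xi; first by rewrite E.
exact: sub_space_ext.
Qed.
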